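(* Let $0<k<1$ and let $w$ be a real number such that $w/K$ is irrational. Let $\Phi_n^{(D)}(z)$, $n=0,1,2,\dots$, be the monic polynomials determined by the reflection parameters $$a_{2n}=\mathrm{dn}(w(2n+1)),\qquad a_{2n+1}=-\mathrm{cn}(w(2n+2)),\qquad n=0,1,2,\dots$$ Then these polynomials satisfy the orthogonality property on the unit circle $$\sum_{s=-\infty}^{\infty}\rho_s\,\Phi_n^{(D)}(z_s)\,\Phi_m^{(D)}(1/z_s)=h_n\,\delta_{nm},\qquad n,m=0,1,2,\dots,$$ where $$z_s=\exp\bigl(i\pi ws/K\bigr)$$ and the discrete weights are $$\rho_s=\frac{\pi}{K}\,\frac{1}{q^{s}+q^{-s}}.$$
   Context: The functions $\mathrm{sn},\mathrm{cn},\mathrm{dn}$ are the Jacobi elliptic functions with modulus $k$. $K=K(k)$ is the complete elliptic integral of the first kind, $K'=K(k')$ with $k'^2=1-k^2$, and $q=\exp(-\pi K'/K)$. The monic polynomials $\Phi_n$ determined by a real sequence of reflection parameters $a_n$ are defined by $\Phi_0(z)=1$ and $\Phi_{n+1}(z)=z\Phi_n(z)-a_n z^n\Phi_n(1/z)$, $n\ge 0$ (so $a_n=-\Phi_{n+1}(0)$). The normalization constants are $h_0=1$ and $h_n=\prod_{j=0}^{n-1}(1-a_j^2)$. *)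

(* Defs.v *)
From mathcomp Require Import all_boot all_algebra.
From mathcomp Require Import reals Rstruct.
From Stdlib Require Import Reals ClassicalEpsilon.
From Coquelicot Require Import Coquelicot.

Set Implicit Arguments.
Unset Strict Implicit.
Unset Printing Implicit Defensive.

(* The key %R now belongs to the R_scope of Reals. *)
Delimit Scope ring_scope with ring.

Local Open Scope R_scope.

Definition ellip_F (k phi : R) : R :=
  RInt (fun t => / sqrt (1 - k ^ 2 * sin t ^ 2)) 0 phi.

Definition ellip_K (k : R) : R := ellip_F k (PI / 2).

Definition nome (k : R) : R :=
  exp (- PI * ellip_K (sqrt (1 - k ^ 2)) / ellip_K k).

(* The amplitude: for 0 <= k < 1 the integrand of [ellip_F k] is continuous and
   at least 1, so [ellip_F k] is a bijection of R and the [phi] chosen here is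
   the unique preimage of [u]. *)
Definition jacobi_am (k u : R) : R :=
  epsilon (inhabits 0) (fun phi => ellip_F k phi = u).

Definition jacobi_sn (k u : R) : R := sin (jacobi_am k u).
Definition jacobi_cn (k u : R) : R := cos (jacobi_am k u).
Definition jacobi_dn (k u : R) : R := sqrt (1 - k ^ 2 * jacobi_sn k u ^ 2).

(* [\poly_(i < n.+1) p`_(n - i)] is z^n p(1/z) for [p] of degree at most [n]. *)
Fixpoint Phi (a : nat -> R) (n : nat) : {poly R} :=
  if n is n'.+1 then
    ('X * Phi a n' - a n' *: \poly_(i < n'.+1) (Phi a n')`_(n' - i))%ring
  else 1%ring.

Definition hnorm (a : nat -> R) (n : nat) : R :=
  (\prod_(j < n) (1 - a j ^+ 2))%ring.

(* Evaluation at a point of Coquelicot's C, which is not a MathComp ring. *)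
Definition Ceval (p : {poly R}) (z : C) : C :=
  sum_n (fun i : nat => (RtoC (p`_i)%ring * z ^ i)%C) (size p).-1.

Definition Cexpi (t : R) : C := (cos t, sin t).

(* A sum over Z converges when the sums over s >= 0 and over s < 0 both do. *)
Definition is_series_Z (f : Z -> C) (l : C) : Prop :=
  exists l1 l2 : C,
    is_series (fun n : nat => f (Z.of_nat n)) l1 /\
    is_series (fun n : nat => f (- Z.of_nat n.+1)%Z) l2 /\
    l = (l1 + l2)%C.

Definition node (k w : R) (s : Z) : C := Cexpi (PI * w * IZR s / ellip_K k).

Definition weight (k : R) (s : Z) : R :=
  PI / ellip_K k * (1 / (powerRZ (nome k) s + powerRZ (nome k) (- s))).

(* Main.v *)
Require Import Defs.
From mathcomp Require Import all_boot all_algebra.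
From mathcomp Require Import reals Rstruct.
From Stdlib Require Import Reals ClassicalEpsilon Lra Psatz Ranalysis5.
From Coquelicot Require Import Coquelicot.

(** The weights are chosen so that the moments are values of dn: since
    [node k w s] to the power j is e^(i pi (j w) s / K), the sum over s of
    [weight k s] times that power is the Fourier series of dn at j w
    ([dn_moment]).  What remains is an identity about the linear functional
    z^j |-> dn (j w).

    Algebra.  Let f_n(u) be the sum over i of the coefficient of z^i in Phi_n
    times dn (u - i w) ([Phi_pairing]); then f_n(j w) is the scalar product of
    Phi_n with z^j.  As dn is even, the recurrence of the Phi_n becomes
    f_(n+1)(u) = f_n(u - w) - a_n f_n(n w - u), and the addition theorems
      dn (u - v) - dn u dn v = k^2 sn u sn v cn (u - v),
      cn (u - v) - cn u cn v = sn u sn v dn (u - v)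
    show by induction that f_n is completely factored: up to a power of k,
    f_n(u) = prod_(j < n) sn ((j + 1) w) sn (u - j w) times dn (u - n w) or
    cn (u - n w) according to the parity of n ([Phi_pairing_dn]).  The zeros at
    u = 0, w, ..., (n - 1) w are the orthogonality, the value at n w is h_n
    ([Phi_orthogonal]).

    Fourier coefficients.  Let P(x, t) and Q(x, t) be the real and imaginary
    parts of dn (x + i t), written with the Jacobi functions of x for the
    modulus k and of t for the complementary modulus.  By the Cauchy-Riemann
    equations ([cauchy_riemann]) and integration by parts over a period, the
    integrals A(t) of P(x, t) cos (s x) and B(t) of Q(x, t) sin (s x) satisfy
    A' = - s B, B' = - s A, so A(t) = A(0) cosh (s t) ([fourier_cosh]).  When t
    tends to K', P becomes pi times a unit mass at x = 0, because P >= 0,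
    P has integral pi and k^2 P sn^2 <= cn(t) -> 0; hence
    A(0) cosh (s K') = pi ([dn_fourier_coef]).

    Convergence.  The coefficients are summable, so by Cesaro it is enough that
    the Fejer means converge to dn.  The Fejer kernel F satisfies
    F(y) (1 - cos y) = 1 - cos ((n + 1) y), and the addition theorem bounds
    the second difference of dn by a multiple of 1 - cos, so the
    error of the n-th mean is O(1/n) ([dn_fourier_series]). *)

Local Open Scope R_scope.

(** * Functions with zero derivative *)

Lemma continuous_is_derive (f : R -> R) (x l : R) :
  is_derive f x l -> continuity_pt f x.
Proof.
move=> h; apply/continuity_pt_filterlim.
by apply: ex_derive_continuous; exists l.
Qed.

Lemma is_derive_0_const_on (f : R -> R) (a b : R)
    (hf : forall x, Rmin a b <= x <= Rmax a b -> is_derive f x 0) : f a = f b.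
Proof.
have [c [_]] := MVT_gen f a b (fun _ => 0)
   (fun x hx => hf x (conj (Rlt_le _ _ (proj1 hx)) (Rlt_le _ _ (proj2 hx))))
   (fun x hx => continuous_is_derive _ _ _ (hf x hx)).
lra.
Qed.

Lemma is_derive_0_const (f : R -> R) (hf : forall x, is_derive f x 0) (a b : R) :
  f a = f b.
Proof. by apply: is_derive_0_const_on => x _. Qed.

(** * The amplitude and the Jacobi functions *)

Lemma Delta_bounds (k : R) (hk : 0 < k < 1) (t : R) :
  1 - k ^ 2 <= 1 - k ^ 2 * sin t ^ 2 <= 1.
Proof.
have h1 : 0 <= sin t ^ 2 <= 1.
  have := sin2_cos2 t; rewrite /Rsqr => h; split; nra.
split; nra.
Qed.

Lemma sqrt_Delta_bounds (k : R) (hk : 0 < k < 1) (t : R) :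
  0 < sqrt (1 - k ^ 2) <= sqrt (1 - k ^ 2 * sin t ^ 2)
  /\ sqrt (1 - k ^ 2 * sin t ^ 2) <= 1.
Proof.
have [h1 h2] := Delta_bounds k hk t.
split; first split.
- apply: sqrt_lt_R0; nra.
- exact: sqrt_le_1_alt.
- rewrite -[X in _ <= X]sqrt_1; exact: sqrt_le_1_alt.
Qed.

Lemma continuous_ellip_F_integrand (k : R) (hk : 0 < k < 1) (t : R) :
  continuous (fun t => / sqrt (1 - k ^ 2 * sin t ^ 2)) t.
Proof.
apply: ex_derive_continuous; auto_derive.
have := Delta_bounds k hk t; have := sqrt_Delta_bounds k hk t.
rewrite /Rminus /= => h1 h2; repeat split; nra.
Qed.

Lemma is_derive_ellip_F (k : R) (hk : 0 < k < 1) (phi : R) :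
  is_derive (ellip_F k) phi (/ sqrt (1 - k ^ 2 * sin phi ^ 2)).
Proof.
apply: (is_derive_RInt (fun t => / sqrt (1 - k ^ 2 * sin t ^ 2)) (ellip_F k) 0).
  apply: filter_forall => y; apply: RInt_correct.
  apply: ex_RInt_continuous => z _; exact: continuous_ellip_F_integrand.
exact: continuous_ellip_F_integrand.
Qed.

(** Mean value theorem: the integrand of [ellip_F] lies between 1 and
    1 / sqrt (1 - k ^ 2). *)
Lemma ellip_F_expansion (k : R) (hk : 0 < k < 1) (a b : R) (hab : a <= b) :
  b - a <= ellip_F k b - ellip_F k a <= (b - a) / sqrt (1 - k ^ 2).
Proof.
have [c [_ ->]] := MVT_gen (ellip_F k) a b
   (fun t => / sqrt (1 - k ^ 2 * sin t ^ 2))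
   (fun x _ => is_derive_ellip_F k hk x)
   (fun x _ => continuous_is_derive _ _ _ (is_derive_ellip_F k hk x)).
have [[h1 h2] h3] := sqrt_Delta_bounds k hk c.
have h4 : 1 <= / sqrt (1 - k ^ 2 * sin c ^ 2).
  rewrite -[X in X <= _]Rinv_1; apply: Rinv_le_contravar; lra.
have h5 : / sqrt (1 - k ^ 2 * sin c ^ 2) <= / sqrt (1 - k ^ 2).
  apply: Rinv_le_contravar; lra.
rewrite /Rdiv; split; nra.
Qed.

Lemma ellip_F_0 (k : R) : ellip_F k 0 = 0.
Proof. exact: RInt_point. Qed.

Lemma ellip_F_surj (k : R) (hk : 0 < k < 1) (u : R) :
  exists phi, ellip_F k phi = u.
Proof.
have [h _] := ellip_F_expansion k hk 0 (Rabs u) (Rabs_pos u).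
have [h' _] := ellip_F_expansion k hk (- Rabs u) 0 ltac:(have := Rabs_pos u; lra).
rewrite ellip_F_0 in h h'.
have [] := IVT_gen (ellip_F k) (- Rabs u) (Rabs u) u.
- move=> x; exact: continuous_is_derive (is_derive_ellip_F k hk x).
- have := Rabs_def2 u (Rabs u + 1) ltac:(lra).
  have := Rle_abs u; have := Rle_abs (- u); rewrite Rabs_Ropp => h1 h2 h3.
  by rewrite Rmin_left ?Rmax_right; lra.
by move=> x [_ hx]; exists x.
Qed.

Lemma ellip_F_am (k : R) (hk : 0 < k < 1) (u : R) :
  ellip_F k (jacobi_am k u) = u.
Proof. exact: (epsilon_spec (inhabits 0) _ (ellip_F_surj k hk u)). Qed.

Lemma ellip_F_inj (k : R) (hk : 0 < k < 1) (a b : R) :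
  ellip_F k a = ellip_F k b -> a = b.
Proof.
move=> e; case: (Rle_lt_dec a b) => h.
  have := ellip_F_expansion k hk a b h; lra.
have := ellip_F_expansion k hk b a ltac:(lra); lra.
Qed.

Lemma am_ellip_F (k : R) (hk : 0 < k < 1) (phi : R) :
  jacobi_am k (ellip_F k phi) = phi.
Proof. by apply: (ellip_F_inj k hk); exact: ellip_F_am. Qed.

Lemma am_expansion (k : R) (hk : 0 < k < 1) (u v : R) (huv : u <= v) :
  sqrt (1 - k ^ 2) * (v - u) <= jacobi_am k v - jacobi_am k u <= v - u.
Proof.
set a := jacobi_am k u; set b := jacobi_am k v.
have eu : ellip_F k a = u := ellip_F_am k hk u.
have ev : ellip_F k b = v := ellip_F_am k hk v.
case: (Rle_lt_dec a b) => h.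
  have [h1 h2] := ellip_F_expansion k hk a b h.
  have [[h3 _] _] := sqrt_Delta_bounds k hk 0.
  split; last by lra.
  have e : (b - a) = sqrt (1 - k ^ 2) * ((b - a) / sqrt (1 - k ^ 2)) by field; lra.
  rewrite e; apply: Rmult_le_compat_l; lra.
have := ellip_F_expansion k hk b a ltac:(lra); lra.
Qed.

Lemma continuous_am (k : R) (hk : 0 < k < 1) (u : R) :
  continuity_pt (jacobi_am k) u.
Proof.
move=> eps heps; exists eps; split => // v [_].
rewrite /dist /= /Rdist => h; apply: Rle_lt_trans h.
case: (Rle_lt_dec u v) => huv.
  have [h1 h2] := am_expansion k hk u v huv.
  have [[h3 _] _] := sqrt_Delta_bounds k hk 0.
  rewrite !Rabs_pos_eq; nra.
have [h1 h2] := am_expansion k hk v u ltac:(lra).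
have [[h3 _] _] := sqrt_Delta_bounds k hk 0.
rewrite (Rabs_minus_sym v) (Rabs_minus_sym (jacobi_am k v)) !Rabs_pos_eq; nra.
Qed.

(** The amplitude is the inverse function of [ellip_F], and the inverse of the
    integrand at [jacobi_am k u] is dn u. *)
Lemma is_derive_am (k : R) (hk : 0 < k < 1) (u : R) :
  is_derive (jacobi_am k) u (jacobi_dn k u).
Proof.
have der x : derivable_pt_lim (ellip_F k) x (/ sqrt (1 - k ^ 2 * sin x ^ 2)).
  exact/is_derive_Reals/is_derive_ellip_F.
(* the derivative of [ellip_F] is read off from this derivability proof by
   computation *)
pose prf (a : R) : jacobi_am k (u - 1) <= a <= jacobi_am k (u + 1) ->
    derivable_pt (ellip_F k) a := fun _ => exist _ _ (der a).
have [h1 h2] := am_expansion k hk (u - 1) u ltac:(lra).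
have [h3 h4] := am_expansion k hk u (u + 1) ltac:(lra).
have [[h5 h6] h7] := sqrt_Delta_bounds k hk (jacobi_am k u).
have inc : jacobi_am k (u - 1) <= jacobi_am k u <= jacobi_am k (u + 1).
  split; nra.
have := derivable_pt_lim_recip_interv (ellip_F k) (jacobi_am k) (u - 1) (u + 1) u
  prf (continuous_am k hk u) ltac:(lra) ltac:(lra) inc.
rewrite /prf /derive_pt /= => H; apply/is_derive_Reals.
have -> : jacobi_dn k u = 1 / (/ sqrt (1 - k * (k * 1) *
      (sin (jacobi_am k u) * (sin (jacobi_am k u) * 1)))).
  rewrite /jacobi_dn /jacobi_sn /=; field; rewrite /= in h5 h6 h7; lra.
apply: H.
  by move=> x _; exact: ellip_F_am.
apply: Rinv_neq_0_compat; rewrite /= in h5 h6 h7; lra.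
Qed.

Lemma sn2_cn2 (k u : R) : jacobi_sn k u ^ 2 + jacobi_cn k u ^ 2 = 1.
Proof. have := sin2_cos2 (jacobi_am k u); rewrite /Rsqr /jacobi_sn /jacobi_cn; nra. Qed.

Lemma dn2 (k : R) (hk : 0 < k < 1) (u : R) :
  jacobi_dn k u ^ 2 = 1 - k ^ 2 * jacobi_sn k u ^ 2.
Proof. rewrite /jacobi_dn pow2_sqrt //; have := Delta_bounds k hk (jacobi_am k u).
rewrite /jacobi_sn; nra. Qed.

Lemma dn_bounds (k : R) (hk : 0 < k < 1) (u : R) :
  0 < sqrt (1 - k ^ 2) <= jacobi_dn k u /\ jacobi_dn k u <= 1.
Proof. exact: sqrt_Delta_bounds. Qed.

Lemma is_derive_sn (k : R) (hk : 0 < k < 1) (u : R) :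
  is_derive (jacobi_sn k) u (jacobi_cn k u * jacobi_dn k u).
Proof.
rewrite Rmult_comm; apply: (is_derive_comp sin (jacobi_am k)); last exact: is_derive_am.
exact: is_derive_sin.
Qed.

Lemma is_derive_cn (k : R) (hk : 0 < k < 1) (u : R) :
  is_derive (jacobi_cn k) u (- (jacobi_sn k u * jacobi_dn k u)).
Proof.
have -> : - (jacobi_sn k u * jacobi_dn k u) = jacobi_dn k u * - jacobi_sn k u by ring.
apply: (is_derive_comp cos (jacobi_am k)); last exact: is_derive_am.
exact: is_derive_cos.
Qed.

Lemma is_derive_dn (k : R) (hk : 0 < k < 1) (u : R) :
  is_derive (jacobi_dn k) u (- (k ^ 2 * jacobi_sn k u * jacobi_cn k u)).
Proof.
have [[h1 h2] h3] := dn_bounds k hk u.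
have h4 := dn2 k hk u.
have h : is_derive (fun u => 1 - k ^ 2 * jacobi_sn k u ^ 2) u
   (- (2 * k ^ 2 * jacobi_sn k u * (jacobi_cn k u * jacobi_dn k u))).
  auto_derive; first by exists (jacobi_cn k u * jacobi_dn k u); exact: is_derive_sn.
  by rewrite (is_derive_unique _ _ _ (is_derive_sn k hk u)); ring.
have hpos : 0 < 1 - k ^ 2 * jacobi_sn k u ^ 2 by rewrite -h4; nra.
have := is_derive_sqrt _ _ _ h hpos.
rewrite -/(jacobi_dn k u) => {}h.
have -> // : - (k ^ 2 * jacobi_sn k u * jacobi_cn k u) =
  - (2 * k ^ 2 * jacobi_sn k u * (jacobi_cn k u * jacobi_dn k u)) / (2 * jacobi_dn k u).
by field; lra.
Qed.


Lemma ellip_F_opp (k : R) (hk : 0 < k < 1) (phi : R) :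
  ellip_F k (- phi) = - ellip_F k phi.
Proof.
rewrite /ellip_F.
have h := is_RInt_comp_opp (fun t => / sqrt (1 - k ^ 2 * sin t ^ 2)) 0 phi
   (RInt (fun t => / sqrt (1 - k ^ 2 * sin t ^ 2)) 0 (- phi)).
rewrite Ropp_0 in h.
have {}h := h (RInt_correct _ _ _ (ex_RInt_continuous _ _ _
   (fun z _ => continuous_ellip_F_integrand k hk z))).
have e := is_RInt_unique _ _ _ _ h.
rewrite -e.
transitivity (RInt (fun t => - / sqrt (1 - k ^ 2 * sin t ^ 2)) 0 phi); last first.
  apply: RInt_opp; apply: ex_RInt_continuous => z _.
  exact: continuous_ellip_F_integrand.
apply: RInt_ext => x _; rewrite sin_neg; congr (- / sqrt _); ring.
Qed.

Lemma am_opp (k : R) (hk : 0 < k < 1) (u : R) : jacobi_am k (- u) = - jacobi_am k u.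
Proof. by apply: (ellip_F_inj k hk); rewrite ellip_F_opp // !ellip_F_am. Qed.

Lemma am_0 (k : R) (hk : 0 < k < 1) : jacobi_am k 0 = 0.
Proof. by apply: (ellip_F_inj k hk); rewrite ellip_F_am // ellip_F_0. Qed.

Lemma sn_opp (k : R) (hk : 0 < k < 1) (u : R) : jacobi_sn k (- u) = - jacobi_sn k u.
Proof. by rewrite /jacobi_sn am_opp // sin_neg. Qed.

Lemma cn_opp (k : R) (hk : 0 < k < 1) (u : R) : jacobi_cn k (- u) = jacobi_cn k u.
Proof. by rewrite /jacobi_cn am_opp // cos_neg. Qed.

Lemma dn_opp (k : R) (hk : 0 < k < 1) (u : R) : jacobi_dn k (- u) = jacobi_dn k u.
Proof. by rewrite /jacobi_dn sn_opp //; congr sqrt; ring. Qed.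

Lemma sn_0 (k : R) (hk : 0 < k < 1) : jacobi_sn k 0 = 0.
Proof. by rewrite /jacobi_sn am_0 // sin_0. Qed.

Lemma cn_0 (k : R) (hk : 0 < k < 1) : jacobi_cn k 0 = 1.
Proof. by rewrite /jacobi_cn am_0 // cos_0. Qed.

Lemma dn_0 (k : R) (hk : 0 < k < 1) : jacobi_dn k 0 = 1.
Proof. by rewrite /jacobi_dn sn_0 // -[RHS]sqrt_1; congr sqrt; ring. Qed.

Lemma ellip_K_pos (k : R) (hk : 0 < k < 1) : 0 < ellip_K k.
Proof.
have := ellip_F_expansion k hk 0 (PI / 2) ltac:(have := PI_RGT_0; lra).
have := PI_RGT_0; rewrite ellip_F_0 /ellip_K; lra.
Qed.

Lemma am_K (k : R) (hk : 0 < k < 1) : jacobi_am k (ellip_K k) = PI / 2.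
Proof. exact: am_ellip_F. Qed.

Lemma cn_K (k : R) (hk : 0 < k < 1) : jacobi_cn k (ellip_K k) = 0.
Proof. by rewrite /jacobi_cn am_K // cos_PI2. Qed.

(** The integrand has period pi, so the difference of the two sides is constant;
    the constant is read off at - pi / 2, where oddness applies. *)
Lemma ellip_F_add_PI (k : R) (hk : 0 < k < 1) (phi : R) :
  ellip_F k (phi + PI) = ellip_F k phi + 2 * ellip_K k.
Proof.
pose g x := ellip_F k (x + PI) - ellip_F k x.
have hg x : is_derive g x 0.
  have -> : 0 = 1 * / sqrt (1 - k ^ 2 * sin (x + PI) ^ 2) - / sqrt (1 - k ^ 2 * sin x ^ 2).
    rewrite neg_sin Rmult_1_l.
    have -> : (- sin x) ^ 2 = sin x ^ 2 by ring.
    by rewrite Rminus_diag.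
  apply: is_derive_minus; last exact: is_derive_ellip_F.
  apply: (is_derive_comp (ellip_F k)); first exact: is_derive_ellip_F.
  by auto_derive => //; ring.
have [c [_]] := MVT_gen g (- (PI / 2)) phi (fun _ => 0) (fun x _ => hg x)
   (fun x _ => continuous_is_derive _ _ _ (hg x)).
rewrite /g ellip_F_opp //.
have -> : - (PI / 2) + PI = PI / 2 by field.
rewrite /ellip_K; lra.
Qed.

Lemma dn_period (k : R) (hk : 0 < k < 1) (u : R) :
  jacobi_dn k (u + 2 * ellip_K k) = jacobi_dn k u.
Proof.
have e : jacobi_am k (u + 2 * ellip_K k) = jacobi_am k u + PI.
  by apply: (ellip_F_inj k hk); rewrite ellip_F_am // ellip_F_add_PI // ellip_F_am.
by rewrite /jacobi_dn /jacobi_sn e neg_sin; congr sqrt; ring.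
Qed.

(** * Addition theorems *)

Lemma addition_denominator_pos (k : R) (hk : 0 < k < 1) (u v : R) :
  1 - k ^ 2 <= 1 - k ^ 2 * jacobi_sn k u ^ 2 * jacobi_sn k v ^ 2
  /\ 0 < 1 - k ^ 2 * jacobi_sn k u ^ 2 * jacobi_sn k v ^ 2.
Proof.
have h1 := sn2_cn2 k u; have h2 := sn2_cn2 k v.
have h3 : 0 <= jacobi_sn k u ^ 2 * jacobi_sn k v ^ 2 <= 1.
  have := pow2_ge_0 (jacobi_sn k u); have := pow2_ge_0 (jacobi_sn k v).
  have := pow2_ge_0 (jacobi_cn k u); have := pow2_ge_0 (jacobi_cn k v).
  split; nra.
split; nra.
Qed.

Ltac jacobi_derive k hk u c :=
  auto_derive;
  [ repeat split; try (by eexists; exact: is_derive_sn);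
    try (by eexists; exact: is_derive_cn); try (by eexists; exact: is_derive_dn)
  | rewrite ?(is_derive_unique _ _ _ (is_derive_sn k hk u))
      ?(is_derive_unique _ _ _ (is_derive_cn k hk u))
      ?(is_derive_unique _ _ _ (is_derive_dn k hk u))
      ?(is_derive_unique _ _ _ (is_derive_sn k hk (c - u)))
      ?(is_derive_unique _ _ _ (is_derive_cn k hk (c - u)))
      ?(is_derive_unique _ _ _ (is_derive_dn k hk (c - u))) ].

(** Euler's argument: along u + v = c the classical expressions for
    cn (u + v) and dn (u + v) have derivative zero, and at u = c they are
    cn c and dn c. *)
Lemma addition_constants (k : R) (hk : 0 < k < 1) (c u : R) :
  (jacobi_cn k u * jacobi_cn k (c - u) -
     jacobi_sn k u * jacobi_sn k (c - u) * jacobi_dn k u * jacobi_dn k (c - u))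
    / (1 - k ^ 2 * jacobi_sn k u ^ 2 * jacobi_sn k (c - u) ^ 2) = jacobi_cn k c
  /\
  (jacobi_dn k u * jacobi_dn k (c - u) -
     k ^ 2 * jacobi_sn k u * jacobi_sn k (c - u) * jacobi_cn k u * jacobi_cn k (c - u))
    / (1 - k ^ 2 * jacobi_sn k u ^ 2 * jacobi_sn k (c - u) ^ 2) = jacobi_dn k c.
Proof.
have hc v : jacobi_cn k v ^ 2 = 1 - jacobi_sn k v ^ 2.
  have := sn2_cn2 k v; lra.
have hd v := dn2 k hk v.
have hD x := proj2 (addition_denominator_pos k hk x (c - x)).
rewrite /= /Rminus in hD.
split.
- pose f u := (jacobi_cn k u * jacobi_cn k (c - u) -
     jacobi_sn k u * jacobi_sn k (c - u) * jacobi_dn k u * jacobi_dn k (c - u))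
    / (1 - k ^ 2 * jacobi_sn k u ^ 2 * jacobi_sn k (c - u) ^ 2).
  have hf x : is_derive f x 0.
    rewrite /f; jacobi_derive k hk x c; first by have := hD x; lra.
    have {hD} := hD x; have := hc x; have := hc (c - x); have := hd x; have := hd (c - x).
    rewrite -/(Rminus c x).
    move: (jacobi_sn k (c - x)) (jacobi_cn k (c - x)) (jacobi_dn k (c - x)) => s2 c2 d2.
    move: (jacobi_sn k x) (jacobi_cn k x) (jacobi_dn k x) => s1 c1 d1 hd2 hd1 hc2 hc1 hD.
    field_simplify_eq; last by lra.
    ring [hd2 hd1 hc2 hc1].
  rewrite -/(f u) (is_derive_0_const f hf u c) /f Rminus_diag sn_0 // cn_0 // dn_0 //.
  field.
- pose f u := (jacobi_dn k u * jacobi_dn k (c - u) -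
     k ^ 2 * jacobi_sn k u * jacobi_sn k (c - u) * jacobi_cn k u * jacobi_cn k (c - u))
    / (1 - k ^ 2 * jacobi_sn k u ^ 2 * jacobi_sn k (c - u) ^ 2).
  have hf x : is_derive f x 0.
    rewrite /f; jacobi_derive k hk x c; first by have := hD x; lra.
    have {hD} := hD x; have := hc x; have := hc (c - x); have := hd x; have := hd (c - x).
    rewrite -/(Rminus c x).
    move: (jacobi_sn k (c - x)) (jacobi_cn k (c - x)) (jacobi_dn k (c - x)) => s2 c2 d2.
    move: (jacobi_sn k x) (jacobi_cn k x) (jacobi_dn k x) => s1 c1 d1 hd2 hd1 hc2 hc1 hD.
    field_simplify_eq; last by lra.
    ring [hd2 hd1 hc2 hc1].
  rewrite -/(f u) (is_derive_0_const f hf u c) /f Rminus_diag sn_0 // cn_0 // dn_0 //.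
  field.
Qed.

Lemma cn_sub (k : R) (hk : 0 < k < 1) (u v : R) :
  jacobi_cn k (u - v) = (jacobi_cn k u * jacobi_cn k v +
     jacobi_sn k u * jacobi_sn k v * jacobi_dn k u * jacobi_dn k v)
    / (1 - k ^ 2 * jacobi_sn k u ^ 2 * jacobi_sn k v ^ 2).
Proof.
have [<- _] := addition_constants k hk (u - v) u.
have -> : u - v - u = - v by ring.
rewrite sn_opp // cn_opp // dn_opp //; congr (_ / _); ring.
Qed.

Lemma dn_sub (k : R) (hk : 0 < k < 1) (u v : R) :
  jacobi_dn k (u - v) = (jacobi_dn k u * jacobi_dn k v +
     k ^ 2 * jacobi_sn k u * jacobi_sn k v * jacobi_cn k u * jacobi_cn k v)
    / (1 - k ^ 2 * jacobi_sn k u ^ 2 * jacobi_sn k v ^ 2).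
Proof.
have [_ <-] := addition_constants k hk (u - v) u.
have -> : u - v - u = - v by ring.
rewrite sn_opp // cn_opp // dn_opp //; congr (_ / _); ring.
Qed.

Lemma dn_sub_prod (k : R) (hk : 0 < k < 1) (u v : R) :
  jacobi_dn k (u - v) - jacobi_dn k u * jacobi_dn k v =
  k ^ 2 * jacobi_sn k u * jacobi_sn k v * jacobi_cn k (u - v).
Proof.
have [_ hD] := addition_denominator_pos k hk u v.
rewrite cn_sub // dn_sub //; field; lra.
Qed.

Lemma cn_sub_prod (k : R) (hk : 0 < k < 1) (u v : R) :
  jacobi_cn k (u - v) - jacobi_cn k u * jacobi_cn k v =
  jacobi_sn k u * jacobi_sn k v * jacobi_dn k (u - v).
Proof.
have [_ hD] := addition_denominator_pos k hk u v.
rewrite cn_sub // dn_sub //; field; lra.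
Qed.

(** * Orthogonality for the moments dn (j w) *)

(** [c] stands for the moment function: with z^j |-> c (j w) as linear
    functional and [c] even, the value at u = j w is the scalar product of
    [Phi a n] with z^j. *)
Definition Phi_pairing (a : nat -> R) (c : R -> R) (w : R) (n : nat) (u : R) : R :=
  (\sum_(i < n.+1) (Phi a n)`_i * c (u - w * INR i)%R)%ring.

(** Reversing the coefficients of [Phi a n] amounts, for even [c], to the
    substitution u |-> n w - u. *)
Lemma Phi_pairing_S (a : nat -> R) (c : R -> R) (c_even : forall u, c (- u) = c u)
    (w : R) (n : nat) (u : R) :
  Phi_pairing a c w n.+1 u =
  Phi_pairing a c w n (u - w) - a n * Phi_pairing a c w n (w * INR n - u).
Proof.
rewrite /Phi_pairing /= RminusE RmultE.
under eq_bigr => i _ do rewrite coefB coefZ coefXM coef_poly GRing.mulrBl.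
rewrite GRing.sumrB; congr (_ - _)%ring.
  rewrite big_ord_recl /= GRing.mul0r GRing.add0r; apply: eq_bigr => i _.
  rewrite -/(INR i.+1) S_INR; congr (_ * c _)%ring; ring.
rewrite big_ord_recr /= ltnn GRing.mulr0 GRing.mul0r GRing.addr0 GRing.mulr_sumr.
rewrite (reindex_inj rev_ord_inj) /=; apply: eq_bigr => i _.
have hi : (i <= n)%nat by rewrite -ltnS.
rewrite subSS ltnS leq_subr subKn // -GRing.mulrA -c_even minus_INR; last exact/leP.
by congr (_ * (_ * c _))%ring; ring.
Qed.

(** Up to sign the n-th reflection parameter is [reflection_fun k n ((n + 1) w)]; the
    two addition formulas exchange the two cases, which makes one induction
    step out of two. *)
Definition reflection_fun (k : R) (n : nat) : R -> R :=
  if odd n then jacobi_cn k else jacobi_dn k.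

Definition reflection_const (k : R) (n : nat) : R := if odd n then 1 else k ^ 2.

Lemma reflection_fun_opp (k : R) (hk : 0 < k < 1) (n : nat) (u : R) :
  reflection_fun k n (- u) = reflection_fun k n u.
Proof. by rewrite /reflection_fun; case: ifP => _; [exact: cn_opp | exact: dn_opp]. Qed.

Lemma reflection_fun_0 (k : R) (hk : 0 < k < 1) (n : nat) : reflection_fun k n 0 = 1.
Proof. by rewrite /reflection_fun; case: ifP => _; [exact: cn_0 | exact: dn_0]. Qed.

Lemma reflection_fun_sub (k : R) (hk : 0 < k < 1) (n : nat) (u v : R) :
  reflection_fun k n (u - v) - reflection_fun k n u * reflection_fun k n v =
  reflection_const k n * jacobi_sn k u * jacobi_sn k v * reflection_fun k n.+1 (u - v).
Proof.
rewrite /reflection_fun /reflection_const /=; case: (odd n) => /=; last exact: dn_sub_prod.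
by rewrite cn_sub_prod //; ring.
Qed.

Lemma reflection_fun_sqr (k : R) (hk : 0 < k < 1) (n : nat) (u : R) :
  1 - reflection_fun k n u ^ 2 = reflection_const k n * jacobi_sn k u ^ 2.
Proof.
rewrite /reflection_fun /reflection_const; case: (odd n); last by rewrite dn2 //; ring.
have := sn2_cn2 k u; lra.
Qed.

(** In the induction step the products of sn in the two terms of
    [Phi_pairing_S] agree up to the sign (-1)^n, because sn is odd; the sign is
    the one in [a n], and [reflection_fun_sub] factors the remaining difference. *)
Lemma Phi_pairing_dn (k w : R) (a : nat -> R) (hk : 0 < k < 1)
    (ha : forall n, a n = (- 1) ^ n * reflection_fun k n (w * INR n.+1)) (n : nat) (u : R) :
  Phi_pairing a (jacobi_dn k) w n u =
  (\prod_(j < n) (reflection_const k j * jacobi_sn k (w * INR j.+1)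
                   * jacobi_sn k (u - w * INR j))%R)%ring
  * reflection_fun k n (u - w * INR n).
Proof.
elim: n u => [|n IH] u.
  by rewrite /Phi_pairing big_ord1 big_ord0 /= coef1.
rewrite Phi_pairing_S; last exact: dn_opp.
rewrite !IH.
(* the products of sn occurring in the two terms and in the result share [G] and [Q] *)
set G := (\prod_(j < n) (reflection_const k j * jacobi_sn k (w * INR j.+1))%R)%ring.
set Q := (\prod_(j < n) (jacobi_sn k (u - w * INR j.+1))%R)%ring.
have -> : (\prod_(j < n) (reflection_const k j * jacobi_sn k (w * INR j.+1) *
     jacobi_sn k (u - w - w * INR j))%R)%ring = G * Q.
  rewrite RmultE /G /Q -big_split; apply: eq_bigr => j _.
  congr (_ * jacobi_sn k _)%R; rewrite -/(INR j.+1) S_INR; ring.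
have -> : (\prod_(j < n) (reflection_const k j * jacobi_sn k (w * INR j.+1) *
     jacobi_sn k (w * INR n - u - w * INR j))%R)%ring = G * ((- 1) ^ n * Q).
  rewrite RmultE big_split; congr (_ * _)%ring.
  rewrite (reindex_inj rev_ord_inj) /=.
  have -> : (- 1) ^ n = (\prod_(j < n) (- 1)%R)%ring.
    by rewrite GRing.prodr_const card_ord RpowE.
  rewrite RmultE /Q -big_split /=; apply: eq_bigr => j _.
  rewrite -[RHS]RmultE minus_INR; last exact/leP.
  have -> : w * INR n - u - w * (INR n - INR j.+1) = - (u - w * INR j.+1) by ring.
  by rewrite sn_opp // -/(INR j.+1); ring.
have -> : (\prod_(j < n.+1) (reflection_const k j * jacobi_sn k (w * INR j.+1) *
     jacobi_sn k (u - w * INR j))%R)%ring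
   = G * (reflection_const k n * jacobi_sn k (w * INR n.+1)) * (jacobi_sn k u * Q).
  rewrite big_split big_ord_recr /= !RmultE; congr (_ * _)%ring.
  by rewrite big_ord_recl /= Rmult_0_r Rminus_0_r; congr (_ * _)%ring.
have -> : w * INR n - u - w * INR n = - u by ring.
have -> : u - w - w * INR n = u - w * INR n.+1 by rewrite S_INR; ring.
rewrite reflection_fun_opp // ha.
have h1 : (- 1) ^ n * (- 1) ^ n = 1.
  rewrite -Rpow_mult_distr; have -> : - (1) * - (1) = 1 by ring.
  exact: pow1.
have := reflection_fun_sub k hk n u (w * INR n.+1) => h2.
transitivity (G * Q * (reflection_fun k n (u - w * INR n.+1)
  - (- 1) ^ n * (- 1) ^ n * (reflection_fun k n u * reflection_fun k n (w * INR n.+1)))).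
  by ring.
by rewrite h1 Rmult_1_l h2; ring.
Qed.

Lemma Phi_pairing_vanish (k w : R) (a : nat -> R) (hk : 0 < k < 1)
    (ha : forall n, a n = (- 1) ^ n * reflection_fun k n (w * INR n.+1)) (n j : nat) :
  (j < n)%nat -> Phi_pairing a (jacobi_dn k) w n (w * INR j) = 0.
Proof.
move=> hj; rewrite Phi_pairing_dn // (bigD1 (Ordinal hj)) //=.
by rewrite Rminus_diag sn_0 // Rmult_0_r GRing.mul0r Rmult_0_l.
Qed.

Lemma Phi_pairing_norm (k w : R) (a : nat -> R) (hk : 0 < k < 1)
    (ha : forall n, a n = (- 1) ^ n * reflection_fun k n (w * INR n.+1)) (n : nat) :
  Phi_pairing a (jacobi_dn k) w n (w * INR n) = hnorm a n.
Proof.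
rewrite Phi_pairing_dn // Rminus_diag reflection_fun_0 // Rmult_1_r big_split /=.
rewrite [X in (_ * X)%ring](reindex_inj rev_ord_inj) /= -big_split /hnorm.
apply: eq_bigr => j _.
have -> : w * INR n - w * INR (n - j.+1)%nat = w * INR j.+1.
  rewrite minus_INR; [ring | exact/leP].
transitivity (1 - a j ^ 2); last by rewrite RminusE RpowE.
have sq1 : ((- 1) ^ j) ^ 2 = 1 by rewrite -pow_mult Nat.mul_comm; exact: pow_1_even.
rewrite ha Rpow_mult_distr sq1 Rmult_1_l reflection_fun_sqr // -/(INR j.+1).
transitivity (reflection_const k j * jacobi_sn k (w * INR j.+1) * jacobi_sn k (w * INR j.+1)) => //.
by ring.
Qed.

Lemma size_Phi (a : nat -> R) (n : nat) :
  size (Phi a n) = n.+1 /\ ((Phi a n)`_n)%ring = 1.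
Proof.
elim: n => [|n [IH1 IH2]] /=; first by rewrite size_poly1 coef1.
have e : (('X * Phi a n - a n *: \poly_(i < n.+1) (Phi a n)`_(n - i))`_n.+1)%ring = 1.
  by rewrite coefB coefZ coefXM coef_poly /= IH2 ltnn GRing.mulr0 GRing.subr0.
split=> //; apply/eqP; rewrite eqn_leq; apply/andP; split; last first.
  rewrite ltnNge; apply/negP => /leq_sizeP /(_ n.+1 (leqnn _)); rewrite e.
  exact: R1_neq_R0.
apply: leq_trans (size_polyD _ _) _; rewrite geq_max; apply/andP; split.
  by apply: leq_trans (size_polyMleq _ _) _; rewrite size_polyX IH1.
rewrite size_polyN; apply: leq_trans (size_scale_leq _ _) _.
by apply: leq_trans (size_poly _ _) _.
Qed.

Lemma Phi_orthogonal (k w : R) (a : nat -> R) (hk : 0 < k < 1)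
    (ha : forall n, a n = (- 1) ^ n * reflection_fun k n (w * INR n.+1)) (n m : nat) :
  (\sum_(j < m.+1) (Phi a m)`_j * Phi_pairing a (jacobi_dn k) w n (w * INR j)%R)%ring
  = if n == m then hnorm a n else 0.
Proof.
wlog le_mn : n m / (m <= n)%nat.
  move=> H; case: (leqP m n) => [|/ltnW] hnm; first exact: H.
  rewrite eq_sym -(_ : (if m == n then hnorm a m else 0) = if m == n then hnorm a n else 0).
    rewrite -H // /Phi_pairing.
    under eq_bigr => j _ do rewrite GRing.mulr_sumr.
    rewrite exchange_big /=; apply: eq_bigr => i _; rewrite GRing.mulr_sumr.
    apply: eq_bigr => j _; rewrite GRing.mulrCA -dn_opp //.
    by congr (_ * (_ * jacobi_dn _ _))%ring; ring.
  by case: eqP => // ->.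
rewrite big_ord_recr /= big1 ?GRing.add0r; last first.
  move=> j _; rewrite Phi_pairing_vanish // ?GRing.mulr0 //.
  by apply: leq_trans le_mn.
case: eqP => [<-|/eqP ne].
  by rewrite (proj2 (size_Phi a n)) GRing.mul1r Phi_pairing_norm.
by rewrite Phi_pairing_vanish ?GRing.mulr0 // ltn_neqAle eq_sym ne.
Qed.

(** * The function dn in the complex plane *)

(** [dn_re] and [dn_im] below are the real and imaginary parts of dn (x + i t),
    obtained from the addition theorem and Jacobi's imaginary transformation
    sn (i t) = i sn' / cn', cn (i t) = 1 / cn', dn (i t) = dn' / cn', where the
    primes refer to the complementary modulus; [dn_den] is their common
    denominator.  [dn_re_dx] and [dn_im_dx] are the derivatives in x. *)
Definition dn_den (k x t : R) : R :=
  1 - jacobi_dn k x ^ 2 * jacobi_sn (sqrt (1 - k ^ 2)) t ^ 2.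

Definition dn_re (k x t : R) : R :=
  jacobi_dn k x * jacobi_cn (sqrt (1 - k ^ 2)) t * jacobi_dn (sqrt (1 - k ^ 2)) t
  / dn_den k x t.

Definition dn_im (k x t : R) : R :=
  - (k ^ 2 * jacobi_sn k x * jacobi_cn k x * jacobi_sn (sqrt (1 - k ^ 2)) t)
  / dn_den k x t.

Definition dn_re_dx (k x t : R) : R :=
  - (k ^ 2 * jacobi_sn k x * jacobi_cn k x * jacobi_cn (sqrt (1 - k ^ 2)) t
     * jacobi_dn (sqrt (1 - k ^ 2)) t
     * (1 + jacobi_dn k x ^ 2 * jacobi_sn (sqrt (1 - k ^ 2)) t ^ 2))
  / dn_den k x t ^ 2.

Definition dn_im_dx (k x t : R) : R :=
  - (k ^ 2 * jacobi_sn (sqrt (1 - k ^ 2)) t * jacobi_dn k x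
     * ((jacobi_cn k x ^ 2 - jacobi_sn k x ^ 2) * dn_den k x t
        - 2 * k ^ 2 * jacobi_sn k x ^ 2 * jacobi_cn k x ^ 2
          * jacobi_sn (sqrt (1 - k ^ 2)) t ^ 2))
  / dn_den k x t ^ 2.

Lemma comodulus_bounds (k : R) (hk : 0 < k < 1) :
  0 < sqrt (1 - k ^ 2) < 1 /\ sqrt (1 - k ^ 2) ^ 2 = 1 - k ^ 2.
Proof.
have h : 0 < 1 - k ^ 2 by nra.
split; last by rewrite pow2_sqrt //; lra.
split; first exact: sqrt_lt_R0.
rewrite -[X in _ < X]sqrt_1; apply: sqrt_lt_1_alt; nra.
Qed.

Lemma cn_pos (k : R) (hk : 0 < k < 1) (t : R) :
  - ellip_K k < t < ellip_K k -> 0 < jacobi_cn k t.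
Proof.
move=> ht; apply: cos_gt_0.
- case: (Rle_lt_dec (jacobi_am k t) (- (PI / 2))) => // h.
  have := ellip_F_expansion k hk _ _ h; rewrite ellip_F_am // ellip_F_opp //.
  rewrite -/(ellip_K k); lra.
- case: (Rle_lt_dec (PI / 2) (jacobi_am k t)) => // h.
  have := ellip_F_expansion k hk _ _ h; rewrite ellip_F_am //.
  rewrite -/(ellip_K k); lra.
Qed.

Lemma dn_den_pos (k : R) (hk : 0 < k < 1) (x t : R) :
  - ellip_K (sqrt (1 - k ^ 2)) < t < ellip_K (sqrt (1 - k ^ 2)) ->
  0 < dn_den k x t.
Proof.
have [hk1 _] := comodulus_bounds k hk.
move=> ht; have h1 := cn_pos _ hk1 t ht; rewrite /dn_den.
have h2 := sn2_cn2 (sqrt (1 - k ^ 2)) t.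
have [h3 h4] := dn_bounds k hk x.
have : jacobi_dn k x ^ 2 <= 1 by nra.
have := pow2_ge_0 (jacobi_sn (sqrt (1 - k ^ 2)) t).
have : 0 < jacobi_cn (sqrt (1 - k ^ 2)) t ^ 2 by nra.
nra.
Qed.

Ltac jacobi_partial k hk hk1 x t :=
  auto_derive;
  [ repeat split; try (by eexists; exact: is_derive_sn);
    try (by eexists; exact: is_derive_cn); try (by eexists; exact: is_derive_dn)
  | rewrite ?(is_derive_unique _ _ _ (is_derive_sn k hk x))
      ?(is_derive_unique _ _ _ (is_derive_cn k hk x))
      ?(is_derive_unique _ _ _ (is_derive_dn k hk x))
      ?(is_derive_unique _ _ _ (is_derive_sn _ hk1 t))
      ?(is_derive_unique _ _ _ (is_derive_cn _ hk1 t))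
      ?(is_derive_unique _ _ _ (is_derive_dn _ hk1 t)) ].

(** Holomorphy of dn in the strip |Im| < K', checked on the explicit formulas.
    [dn_den] has no zero in this strip. *)
Lemma cauchy_riemann (k : R) (hk : 0 < k < 1) (x t : R)
    (ht : - ellip_K (sqrt (1 - k ^ 2)) < t < ellip_K (sqrt (1 - k ^ 2))) :
  (is_derive (fun x => dn_re k x t) x (dn_re_dx k x t) /\
   is_derive (fun x => dn_im k x t) x (dn_im_dx k x t)) /\
  (is_derive (fun t => dn_im k x t) t (dn_re_dx k x t) /\
   is_derive (fun t => dn_re k x t) t (- dn_im_dx k x t)).
Proof.
have hD := dn_den_pos k hk x t ht.
have [hk1 ek1] := comodulus_bounds k hk.
have hc v : jacobi_cn k v ^ 2 = 1 - jacobi_sn k v ^ 2.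
  have := sn2_cn2 k v; lra.
have hd v := dn2 k hk v.
have hc1 v : jacobi_cn (sqrt (1 - k ^ 2)) v ^ 2 = 1 - jacobi_sn (sqrt (1 - k ^ 2)) v ^ 2.
  have := sn2_cn2 (sqrt (1 - k ^ 2)) v; lra.
have hd1 v := dn2 _ hk1 v; rewrite ek1 in hd1.
have {hc} := hc x; have {hd} := hd x; have {hc1} := hc1 t; have {hd1} := hd1 t.
move=> hd1 hc1 hd hc.
rewrite /dn_den /= /Rminus in hD.
rewrite /dn_re /dn_im /dn_re_dx /dn_im_dx /dn_den.
set k1 := sqrt (1 - k ^ 2) in hk1 ek1 hd1 hc1 hD *.
split; split; jacobi_partial k hk hk1 x t; try (by move: hD; rewrite /=; lra).
all: rewrite ?ek1; clear hk1 ek1 ht;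
  move: (jacobi_sn k1 t) (jacobi_cn k1 t) (jacobi_dn k1 t) hD hd1 hc1 => s1 c1 d1;
  move: (jacobi_sn k x) (jacobi_cn k x) (jacobi_dn k x) hd hc => s c d hd hc hD hd1 hc1.
all: field_simplify_eq; [ ring [hd hc hd1 hc1] | lra ].
Qed.

(** Differentiation under the integral sign, with the derivative of the
    integrand given explicitly instead of through [Derive]. *)
Lemma is_derive_RInt_parameter (f df : R -> R -> R) (a b lo hi t : R)
    (ht : lo < t < hi)
    (hder : forall y x, lo < y < hi -> is_derive (fun z => f z x) y (df y x))
    (hdf : forall x, continuity_2d_pt df t x)
    (hf : forall y x, lo < y < hi -> continuous (f y) x) :
  is_derive (fun z => RInt (f z) a b) t (RInt (df t) a b).
Proof.
have loc : locally t (fun y => lo < y < hi).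
  apply: (locally_interval _ t lo hi) => //=; lra.
have -> : RInt (df t) a b = RInt (fun x => Derive (fun z => f z x) t) a b.
  apply: RInt_ext => x _; symmetry; apply: is_derive_unique; exact: hder.
apply: is_derive_RInt_param.
- by apply: filter_imp loc => y hy x _; exists (df y x); exact: hder.
- move=> x _; apply: continuity_2d_pt_ext_loc (hdf x).
  have [d hd] := loc; exists d => u v hu hv; symmetry.
  by apply: is_derive_unique; apply: hder; apply: hd.
- apply: filter_imp loc => y hy; apply: ex_RInt_continuous => z _; exact: hf.
Qed.

Lemma continuity_2d_pt_fst (f : R -> R) (u v : R) :
  continuity_pt f u -> continuity_2d_pt (fun x _ => f x) u v.
Proof.
move=> /continuity_pt_locally h eps; have [d hd] := h eps.
by exists d => x y hx _; apply: hd.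
Qed.

Lemma continuity_2d_pt_snd (f : R -> R) (u v : R) :
  continuity_pt f v -> continuity_2d_pt (fun _ y => f y) u v.
Proof.
move=> /continuity_pt_locally h eps; have [d hd] := h eps.
by exists d => x y _ hy; apply: hd.
Qed.

Lemma continuity_2d_pt_pow (f : R -> R -> R) (n : nat) (u v : R) :
  continuity_2d_pt f u v -> continuity_2d_pt (fun x y => f x y ^ n) u v.
Proof.
move=> hf; elim: n => [|n IH] /=; first exact: continuity_2d_pt_const.
exact: continuity_2d_pt_mult.
Qed.

Lemma continuous_of_2d (f : R -> R -> R) (u v : R) :
  continuity_2d_pt f u v -> continuous (f u) v.
Proof.
move=> h; apply/continuity_pt_filterlim/continuity_pt_locally => eps.
have [d hd] := h eps; exists d => y hy; apply: hd => //.
by rewrite Rminus_diag Rabs_R0; exact: cond_pos.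
Qed.

Ltac continuity_2d k hk hk1 :=
  repeat first
    [ apply: continuity_2d_pt_mult | apply: continuity_2d_pt_minus
    | apply: continuity_2d_pt_opp | apply: continuity_2d_pt_plus
    | apply: continuity_2d_pt_const | apply: continuity_2d_pt_pow
    | apply: (continuity_2d_pt_inv (fun _ _ => _ ^ 2))
    | apply: continuity_2d_pt_inv
    | apply: continuity_2d_pt_snd; exact: continuous_is_derive (is_derive_sn k hk _)
    | apply: continuity_2d_pt_snd; exact: continuous_is_derive (is_derive_cn k hk _)
    | apply: continuity_2d_pt_snd; exact: continuous_is_derive (is_derive_dn k hk _)
    | apply: continuity_2d_pt_fst; exact: continuous_is_derive (is_derive_sn _ hk1 _)
    | apply: continuity_2d_pt_fst; exact: continuous_is_derive (is_derive_cn _ hk1 _)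
    | apply: continuity_2d_pt_fst; exact: continuous_is_derive (is_derive_dn _ hk1 _) ].

Lemma continuity_dn_dx (k : R) (hk : 0 < k < 1) (x t : R)
    (ht : - ellip_K (sqrt (1 - k ^ 2)) < t < ellip_K (sqrt (1 - k ^ 2))) :
  continuity_2d_pt (fun t x => dn_re_dx k x t) t x /\
  continuity_2d_pt (fun t x => dn_im_dx k x t) t x.
Proof.
have hD := dn_den_pos k hk x t ht.
have [hk1 ek1] := comodulus_bounds k hk.
rewrite /dn_re_dx /dn_im_dx /Rdiv; split; rewrite /dn_den; continuity_2d k hk hk1.
all: rewrite -/(dn_den k x t); nra.
Qed.

Lemma RInt_by_parts (f df g dg : R -> R) (a b : R)
    (hf : forall x, is_derive f x (df x)) (hg : forall x, is_derive g x (dg x))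
    (cdf : forall x, continuous df x) (cdg : forall x, continuous dg x)
    (hab : f a * g a = f b * g b) :
  RInt (fun x => df x * g x) a b = - RInt (fun x => f x * dg x) a b.
Proof.
have cf x : continuous f x by apply: ex_derive_continuous; eexists; exact: hf.
have cg x : continuous g x by apply: ex_derive_continuous; eexists; exact: hg.
have h : is_RInt (fun x => df x * g x + f x * dg x) a b (minus (f b * g b) (f a * g a)).
  apply: (is_RInt_derive (fun x => f x * g x)) => x _.
    by apply: (is_derive_mult f g x _ _ (hf x) (hg x)) => *; exact: Rmult_comm.
  by apply: continuous_plus; apply: continuous_mult.
have h2 : is_RInt (fun x => f x * dg x) a b (RInt (fun x => f x * dg x) a b).
  apply: RInt_correct; apply: ex_RInt_continuous => x _.
  by apply: continuous_mult.
have h3 := is_RInt_minus _ _ _ _ _ _ h h2.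
have -> : - RInt (fun x => f x * dg x) a b =
    minus (minus (f b * g b) (f a * g a)) (RInt (fun x => f x * dg x) a b).
  by rewrite hab /minus /plus /opp /=; ring.
rewrite -(is_RInt_unique _ _ _ _ h3); apply: RInt_ext => x _.
by rewrite /minus /plus /opp /=; ring.
Qed.

(** Cauchy-Riemann turns a derivative in t into one in x, and integration by
    parts moves it to the trigonometric factor.  The boundary terms vanish
    because cn (K) = 0 in the first case and sin (s K) = 0 in the second. *)
Lemma fourier_system (k : R) (hk : 0 < k < 1) (s t : R)
    (hs : sin (s * ellip_K k) = 0)
    (ht : - ellip_K (sqrt (1 - k ^ 2)) < t < ellip_K (sqrt (1 - k ^ 2))) :
  let A t := RInt (fun x => dn_re k x t * cos (s * x)) (- ellip_K k) (ellip_K k) in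
  let B t := RInt (fun x => dn_im k x t * sin (s * x)) (- ellip_K k) (ellip_K k) in
  is_derive A t (- (s * B t)) /\ is_derive B t (- (s * A t)).
Proof.
move=> A B.
have dcos x : is_derive (fun x => cos (s * x)) x (- (s * sin (s * x))).
  by auto_derive => //; ring.
have dsin x : is_derive (fun x => sin (s * x)) x (s * cos (s * x)).
  by auto_derive => //; ring.
have ccos := fun u x => continuity_2d_pt_snd (fun x => cos (s * x)) u x
   (continuous_is_derive _ _ _ (dcos x)).
have csin := fun u x => continuity_2d_pt_snd (fun x => sin (s * x)) u x
   (continuous_is_derive _ _ _ (dsin x)).
have CR x y hy := cauchy_riemann k hk x y hy.
have C2 x y hy := continuity_dn_dx k hk x y hy.
have cP y x : - ellip_K (sqrt (1 - k ^ 2)) < y < ellip_K (sqrt (1 - k ^ 2)) ->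
    continuous (fun x => dn_re k x y) x.
  by move=> hy; apply: ex_derive_continuous; eexists; exact: (proj1 (proj1 (CR x y hy))).
have cQ y x : - ellip_K (sqrt (1 - k ^ 2)) < y < ellip_K (sqrt (1 - k ^ 2)) ->
    continuous (fun x => dn_im k x y) x.
  by move=> hy; apply: ex_derive_continuous; eexists; exact: (proj2 (proj1 (CR x y hy))).
have c0 x : continuous (fun x => cos (s * x)) x.
  by apply: ex_derive_continuous; eexists; exact: dcos.
have c1 x : continuous (fun x => sin (s * x)) x.
  by apply: ex_derive_continuous; eexists; exact: dsin.
have scalE (l : R) (f : R -> R) : (forall x, continuous f x) ->
    RInt (fun x => l * f x) (- ellip_K k) (ellip_K k) =
    l * RInt f (- ellip_K k) (ellip_K k).
  move=> hf; apply: (RInt_scal f); apply: ex_RInt_continuous => x _; exact: hf.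
split.
- have -> : - (s * B t) =
      RInt (fun x => - dn_im_dx k x t * cos (s * x)) (- ellip_K k) (ellip_K k).
    have -> : RInt (fun x => - dn_im_dx k x t * cos (s * x)) (- ellip_K k) (ellip_K k)
       = - RInt (fun x => - dn_im k x t * - (s * sin (s * x))) (- ellip_K k) (ellip_K k).
      apply: RInt_by_parts => //.
      + move=> x; apply: (is_derive_opp (fun x => dn_im k x t)).
        exact: (proj2 (proj1 (CR x t ht))).
      + move=> x; apply: (continuous_opp (fun x => dn_im_dx k x t)).
        exact: (continuous_of_2d _ _ _ (proj2 (C2 x t ht))).
      + move=> x; apply: (continuous_opp (fun x => s * sin (s * x))).
        by apply: continuous_mult => //; exact: continuous_const.
      + by rewrite /dn_im cn_opp // cn_K // /Rdiv; ring.
    congr (- _); rewrite -scalE; first by apply: RInt_ext => x _ /=; ring.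
    by move=> x; apply: continuous_mult => //; exact: cQ.
  apply: (is_derive_RInt_parameter (fun t x => dn_re k x t * cos (s * x))
    (fun t x => - dn_im_dx k x t * cos (s * x)) _ _ _ _ _ ht).
  + move=> y x hy; rewrite [X in is_derive _ _ X]Rmult_comm.
    have e : is_derive (fun z => cos (s * x) * dn_re k x z) y
      (cos (s * x) * - dn_im_dx k x y).
      by apply: is_derive_scal; exact: (proj2 (proj2 (CR x y hy))).
    by apply: is_derive_ext e => z; exact: Rmult_comm.
  + move=> x; apply: continuity_2d_pt_mult => //; apply: continuity_2d_pt_opp.
    exact: (proj2 (C2 x t ht)).
  + by move=> y x hy; apply: continuous_mult => //; exact: cP.
- have -> : - (s * A t) =
      RInt (fun x => dn_re_dx k x t * sin (s * x)) (- ellip_K k) (ellip_K k).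
    have -> : RInt (fun x => dn_re_dx k x t * sin (s * x)) (- ellip_K k) (ellip_K k)
       = - RInt (fun x => dn_re k x t * (s * cos (s * x))) (- ellip_K k) (ellip_K k).
      apply: RInt_by_parts => //.
      + by move=> x; exact: (proj1 (proj1 (CR x t ht))).
      + by move=> x; exact: (continuous_of_2d _ _ _ (proj1 (C2 x t ht))).
      + by move=> x; apply: continuous_mult => //; exact: continuous_const.
      + have -> : s * - ellip_K k = - (s * ellip_K k) by ring.
        by rewrite sin_neg hs; ring.
    congr (- _); rewrite -scalE; first by apply: RInt_ext => x _ /=; ring.
    by move=> x; apply: continuous_mult => //; exact: cP.
  apply: (is_derive_RInt_parameter (fun t x => dn_im k x t * sin (s * x))
    (fun t x => dn_re_dx k x t * sin (s * x)) _ _ _ _ _ ht).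
  + move=> y x hy; rewrite [X in is_derive _ _ X]Rmult_comm.
    have e : is_derive (fun z => sin (s * x) * dn_im k x z) y
      (sin (s * x) * dn_re_dx k x y).
      by apply: is_derive_scal; exact: (proj1 (proj2 (CR x y hy))).
    by apply: is_derive_ext e => z; exact: Rmult_comm.
  + move=> x; apply: continuity_2d_pt_mult => //.
    exact: (proj1 (C2 x t ht)).
  + by move=> y x hy; apply: continuous_mult => //; exact: cQ.
Qed.

(** * Fourier coefficients of dn *)

Lemma dn_re_0 (k : R) (hk : 0 < k < 1) (x : R) : dn_re k x 0 = jacobi_dn k x.
Proof.
have [hk1 _] := comodulus_bounds k hk.
by rewrite /dn_re /dn_den sn_0 // cn_0 // dn_0 //; field.
Qed.

(** The system of [fourier_system] says that A + B and A - B are multiples of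
    exp (- s t) and exp (s t), and B vanishes at t = 0. *)
Lemma fourier_cosh (k : R) (hk : 0 < k < 1) (s t : R)
    (hs : sin (s * ellip_K k) = 0) (ht : 0 <= t < ellip_K (sqrt (1 - k ^ 2))) :
  RInt (fun x => dn_re k x t * cos (s * x)) (- ellip_K k) (ellip_K k) =
  RInt (fun x => jacobi_dn k x * cos (s * x)) (- ellip_K k) (ellip_K k)
  * ((exp (s * t) + exp (- (s * t))) / 2).
Proof.
have [hk1 _] := comodulus_bounds k hk.
pose A t := RInt (fun x => dn_re k x t * cos (s * x)) (- ellip_K k) (ellip_K k).
pose B t := RInt (fun x => dn_im k x t * sin (s * x)) (- ellip_K k) (ellip_K k).
have sys y : - ellip_K (sqrt (1 - k ^ 2)) < y < ellip_K (sqrt (1 - k ^ 2)) ->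
   is_derive A y (- (s * B y)) /\ is_derive B y (- (s * A y)) := fourier_system k hk s y hs.
have A0 : A 0 = RInt (fun x => jacobi_dn k x * cos (s * x)) (- ellip_K k) (ellip_K k).
  by apply: RInt_ext => x _; rewrite dn_re_0.
have B0 : B 0 = 0.
  rewrite /B (RInt_ext _ (fun _ => 0)); first by rewrite RInt_const scal_zero_r.
  by move=> x _ /=; rewrite /dn_im sn_0 // /Rdiv /=; ring.
have rng x : Rmin 0 t <= x <= Rmax 0 t ->
    - ellip_K (sqrt (1 - k ^ 2)) < x < ellip_K (sqrt (1 - k ^ 2)).
  rewrite Rmin_left ?Rmax_right; lra.
have p : (A 0 + B 0) * exp (s * 0) = (A t + B t) * exp (s * t).
  apply: (is_derive_0_const_on (fun t => (A t + B t) * exp (s * t))) => x hx.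
  have [hA hB] := sys x (rng x hx).
  auto_derive; first by repeat split; eexists; [exact: hA | exact: hB].
  by rewrite (is_derive_unique _ _ _ hA) (is_derive_unique _ _ _ hB); ring.
have m : (A 0 - B 0) * exp (- (s * 0)) = (A t - B t) * exp (- (s * t)).
  apply: (is_derive_0_const_on (fun t => (A t - B t) * exp (- (s * t)))) => x hx.
  have [hA hB] := sys x (rng x hx).
  auto_derive; first by repeat split; eexists; [exact: hA | exact: hB].
  by rewrite (is_derive_unique _ _ _ hA) (is_derive_unique _ _ _ hB); ring.
rewrite -/(A t) -A0.
have E : exp (s * t) * exp (- (s * t)) = 1 by rewrite -exp_plus Rplus_opp_r exp_0.
rewrite B0 Rmult_0_r Ropp_0 exp_0 in p m.
have p' : A t + B t = A 0 * exp (- (s * t)).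
  transitivity ((A t + B t) * (exp (s * t) * exp (- (s * t)))); first by rewrite E; ring.
  by rewrite -Rmult_assoc -p; ring.
have m' : A t - B t = A 0 * exp (s * t).
  transitivity ((A t - B t) * (exp (s * t) * exp (- (s * t)))); first by rewrite E; ring.
  transitivity ((A t - B t) * exp (- (s * t)) * exp (s * t)); first by ring.
  by rewrite -m; ring.
lra.
Qed.

Lemma sin_sqr_le (x : R) : sin x ^ 2 <= x ^ 2.
Proof.
have [c [_]] := MVT_gen sin 0 x cos (fun x _ => is_derive_sin x)
   (fun x _ => continuous_is_derive _ _ _ (is_derive_sin x)).
rewrite sin_0 !Rminus_0_r => ->.
have : cos c ^ 2 <= 1 by have := sin2_cos2 c; rewrite /Rsqr; nra.
have := pow2_ge_0 x; nra.
Qed.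

(** A weak form of Jordan's inequality; the Taylor polynomial of degree 7 gives
    sin x >= x / 3 as far as x = 2 >= pi / 2. *)
Lemma sin_sqr_ge (x : R) : - (PI / 2) <= x <= PI / 2 -> x ^ 2 <= 9 * sin x ^ 2.
Proof.
wlog hx : x / 0 <= x.
  move=> H; case: (Rle_lt_dec 0 x) => [|h] hx; first exact: H.
  have := H (- x) ltac:(lra) ltac:(lra); rewrite sin_neg; nra.
move=> h; have pi4 := PI_4.
have [h1 _] := SIN x hx ltac:(lra).
suff : x / 3 <= sin x by move=> h2; nra.
apply: Rle_trans h1.
have -> : sin_lb x = x / 3 + x * ((4 - x ^ 2) / 6 + (x ^ 2) ^ 2 * (42 - x ^ 2) / 5040).
  by rewrite /sin_lb /sin_approx /sum_f_R0 /sin_term /=; field.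
have y4 : x ^ 2 <= 4 by nra.
have : 0 <= (x ^ 2) ^ 2 * (42 - x ^ 2).
  apply: Rmult_le_pos; [exact: pow2_ge_0 | lra].
nra.
Qed.

Lemma one_sub_cos_le (x : R) : 0 <= 1 - cos x <= x ^ 2 / 2.
Proof.
have -> : 1 - cos x = 2 * sin (x / 2) ^ 2.
  have {1}-> : x = 2 * (x / 2) by field.
  by rewrite cos_2a_sin; ring.
have := sin_sqr_le (x / 2); have := pow2_ge_0 (sin (x / 2)); lra.
Qed.

Lemma one_sub_cos_ge (x : R) : - PI <= x <= PI -> x ^ 2 / 18 <= 1 - cos x.
Proof.
move=> hx.
have -> : 1 - cos x = 2 * sin (x / 2) ^ 2.
  have {1}-> : x = 2 * (x / 2) by field.
  by rewrite cos_2a_sin; ring.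
have := sin_sqr_ge (x / 2); lra.
Qed.

Lemma am_sqr_bounds (k : R) (hk : 0 < k < 1) (x : R) :
  (1 - k ^ 2) * x ^ 2 <= jacobi_am k x ^ 2 <= x ^ 2.
Proof.
have [[h1 h2] h3] := comodulus_bounds k hk.
rewrite -h3; case: (Rle_lt_dec 0 x) => hx.
  have := am_expansion k hk 0 x hx; rewrite am_0 // !Rminus_0_r => -[h4 h5].
  have : 0 <= sqrt (1 - k ^ 2) * x by nra.
  split; nra.
have := am_expansion k hk x 0 ltac:(lra); rewrite am_0 // !Rminus_0_l => -[h4 h5].
have : 0 <= sqrt (1 - k ^ 2) * - x by nra.
split; nra.
Qed.

Lemma sn_sqr_ge (k : R) (hk : 0 < k < 1) (x : R) :
  - ellip_K k <= x <= ellip_K k -> (1 - k ^ 2) * x ^ 2 <= 9 * jacobi_sn k x ^ 2.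
Proof.
move=> hx; have [h1 _] := am_sqr_bounds k hk x.
apply: Rle_trans h1 _; apply: sin_sqr_ge.
have [h1 _] := am_expansion k hk _ _ (proj1 hx).
have [h2 _] := am_expansion k hk _ _ (proj2 hx).
have [[h3 _] _] := comodulus_bounds k hk.
rewrite am_opp // am_K // in h1 h2; split; nra.
Qed.

Lemma sn_sqr_le (k : R) (hk : 0 < k < 1) (x : R) : jacobi_sn k x ^ 2 <= x ^ 2.
Proof.
have [_ h] := am_sqr_bounds k hk x; apply: Rle_trans h; exact: sin_sqr_le.
Qed.

Lemma RInt_dn (k : R) (hk : 0 < k < 1) :
  RInt (jacobi_dn k) (- ellip_K k) (ellip_K k) = PI.
Proof.
have h : is_RInt (jacobi_dn k) (- ellip_K k) (ellip_K k)
   (minus (jacobi_am k (ellip_K k)) (jacobi_am k (- ellip_K k))).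
  apply: is_RInt_derive => x _; first exact: is_derive_am.
  by apply: ex_derive_continuous; eexists; exact: is_derive_dn.
rewrite (is_RInt_unique _ _ _ _ h) am_opp // am_K // /minus /plus /opp /=; field.
Qed.

(** This is what makes [dn_re] concentrate at x = 0 as t tends to K': away from
    the zero of sn it is at most a multiple of cn (t), which tends to 0. *)
Lemma dn_re_bound (k : R) (hk : 0 < k < 1) (x t : R)
    (ht : 0 <= t < ellip_K (sqrt (1 - k ^ 2))) :
  0 <= k ^ 2 * (dn_re k x t * jacobi_sn k x ^ 2) <= jacobi_cn (sqrt (1 - k ^ 2)) t.
Proof.
have [hk1 _] := comodulus_bounds k hk.
have ht' : - ellip_K (sqrt (1 - k ^ 2)) < t < ellip_K (sqrt (1 - k ^ 2)) by lra.
have hD := dn_den_pos k hk x t ht'.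
have hc := cn_pos _ hk1 t ht'.
have [[_ h1] h2] := dn_bounds k hk x.
have [[_ h3] h4] := dn_bounds _ hk1 t.
have [[h5 _] _] := comodulus_bounds k hk.
have [[h6 _] _] := comodulus_bounds _ hk1.
have hd := dn2 k hk x.
have hs1 : jacobi_sn (sqrt (1 - k ^ 2)) t ^ 2 <= 1.
  have := sn2_cn2 (sqrt (1 - k ^ 2)) t; nra.
have hDk : k ^ 2 * jacobi_sn k x ^ 2 <= dn_den k x t.
  by rewrite /dn_den; have := pow2_ge_0 (jacobi_dn k x); nra.
have h0 : 0 <= k ^ 2 * jacobi_sn k x ^ 2 by nra.
have -> : k ^ 2 * (dn_re k x t * jacobi_sn k x ^ 2) =
  jacobi_cn (sqrt (1 - k ^ 2)) t * (jacobi_dn k x * jacobi_dn (sqrt (1 - k ^ 2)) t)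
  * (k ^ 2 * jacobi_sn k x ^ 2 / dn_den k x t).
  by rewrite /dn_re; field; lra.
have h7 : 0 <= k ^ 2 * jacobi_sn k x ^ 2 / dn_den k x t <= 1.
  split; first by apply: Rdiv_le_0_compat.
  by apply/Rle_div_l; lra.
have h8 : 0 <= jacobi_dn k x * jacobi_dn (sqrt (1 - k ^ 2)) t <= 1 by split; nra.
set p := jacobi_dn k x * _ in h8 *.
set r := _ / _ in h7 *.
have h9 : 0 <= p * r <= 1 by split; nra.
rewrite Rmult_assoc; split; nra.
Qed.

(** By [fourier_cosh] with frequency 0 the integral of [dn_re] stays equal to
    pi.  For frequency s, the integral A cosh (s t) differs from it by that of
    [dn_re] times 1 - cos (s x), which is at most a multiple of [dn_re] sn^2,
    hence of cn (t).  The conclusion is the limit t -> K', where cn = 0. *)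
Lemma dn_fourier_coef (k : R) (hk : 0 < k < 1) (s : R) (hs : sin (s * ellip_K k) = 0) :
  RInt (fun x => jacobi_dn k x * cos (s * x)) (- ellip_K k) (ellip_K k) *
  (exp (s * ellip_K (sqrt (1 - k ^ 2))) + exp (- (s * ellip_K (sqrt (1 - k ^ 2))))) = 2 * PI.
Proof.
have [hk1 _] := comodulus_bounds k hk.
have hK := ellip_K_pos k hk.
have hK1 := ellip_K_pos _ hk1.
set K := ellip_K k in hs hK *.
set K1 := ellip_K (sqrt (1 - k ^ 2)) in hK1 *.
set A := RInt _ _ _.
(* 1 - cos (s x) <= (s x)^2 / 2 and (1 - k^2) x^2 <= 9 sn^2 x on the period *)
pose M := 9 * s ^ 2 / (2 * (1 - k ^ 2) * k ^ 2) * (K - - K).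
have bound t : 0 <= t < K1 ->
    Rabs (A * ((exp (s * t) + exp (- (s * t))) / 2) - PI)
    <= M * jacobi_cn (sqrt (1 - k ^ 2)) t.
  move=> ht; rewrite -(fourier_cosh k hk s t hs ht).
  have mass : RInt (fun x => dn_re k x t) (- K) K = PI.
    have := fourier_cosh k hk 0 t ltac:(by rewrite Rmult_0_l sin_0) ht.
    have e f : RInt (fun x => f x * cos (0 * x)) (- K) K = RInt f (- K) K.
      by apply: RInt_ext => x _; rewrite Rmult_0_l cos_0 Rmult_1_r.
    by rewrite !e RInt_dn // Rmult_0_l Ropp_0 exp_0 => -> /=; field.
  have cP x : continuous (fun x => dn_re k x t) x.
    apply: ex_derive_continuous; eexists.
    by apply: (proj1 (proj1 (cauchy_riemann k hk x t _))); rewrite -/K1; lra.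
  have cC x : continuous (fun x => cos (s * x)) x.
    by apply: ex_derive_continuous; auto_derive.
  have ex1 : ex_RInt (fun x => dn_re k x t * cos (s * x)) (- K) K.
    by apply: ex_RInt_continuous => x _; apply: continuous_mult.
  have ex2 : ex_RInt (fun x => dn_re k x t) (- K) K.
    by apply: ex_RInt_continuous => x _.
  have -> : RInt (fun x => dn_re k x t * cos (s * x)) (- K) K - PI =
     RInt (fun x => dn_re k x t * cos (s * x) - dn_re k x t) (- K) K.
    by rewrite -mass; symmetry; exact: (RInt_minus _ _ _ _ ex1 ex2).
  have -> : M * jacobi_cn (sqrt (1 - k ^ 2)) t =
    (K - - K) * (9 * s ^ 2 / (2 * (1 - k ^ 2) * k ^ 2) * jacobi_cn (sqrt (1 - k ^ 2)) t).
    by rewrite /M; ring.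
  apply: abs_RInt_le_const; [lra | exact: ex_RInt_minus | ].
  move=> x hx.
  have [h1 h2] := dn_re_bound k hk x t ht.
  have h3 := sn_sqr_ge k hk x hx.
  have [h4 h5] := one_sub_cos_le (s * x).
  have k2 : 0 < k ^ 2 by nra.
  have k2' : 0 < 1 - k ^ 2 by nra.
  have P0 : 0 <= dn_re k x t.
    have ht' : - K1 < t < K1 by lra.
    have hD := dn_den_pos k hk x t ht'; have hc := cn_pos _ hk1 t ht'.
    have [[h6 h7] _] := dn_bounds k hk x; have [[h8 h9] _] := dn_bounds _ hk1 t.
    by apply: Rdiv_le_0_compat => //; apply: Rmult_le_pos; nra.
  have -> : dn_re k x t * cos (s * x) - dn_re k x t = - (dn_re k x t * (1 - cos (s * x))) by ring.
  rewrite Rabs_Ropp Rabs_pos_eq; last by nra.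
  have h6 : 1 - cos (s * x) <= 9 * s ^ 2 / (2 * (1 - k ^ 2)) * jacobi_sn k x ^ 2.
    apply: Rle_trans h5 _.
    have -> : 9 * s ^ 2 / (2 * (1 - k ^ 2)) * jacobi_sn k x ^ 2
        = (s ^ 2 * (9 * jacobi_sn k x ^ 2)) / (2 * (1 - k ^ 2)) by field; lra.
    have -> : (s * x) ^ 2 / 2 = (s ^ 2 * ((1 - k ^ 2) * x ^ 2)) / (2 * (1 - k ^ 2)).
      by field; lra.
    apply: Rmult_le_compat_r; first by apply/Rlt_le/Rinv_0_lt_compat; lra.
    by apply: Rmult_le_compat_l => //; exact: pow2_ge_0.
  apply: Rle_trans (Rmult_le_compat_l _ _ _ P0 h6) _.
  have -> : dn_re k x t * (9 * s ^ 2 / (2 * (1 - k ^ 2)) * jacobi_sn k x ^ 2) =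
    9 * s ^ 2 / (2 * (1 - k ^ 2) * k ^ 2) * (k ^ 2 * (dn_re k x t * jacobi_sn k x ^ 2)).
    by field; lra.
  apply: Rmult_le_compat_l => //; apply: Rdiv_le_0_compat; nra.
pose G t := M * jacobi_cn (sqrt (1 - k ^ 2)) t
   - Rabs (A * ((exp (s * t) + exp (- (s * t))) / 2) - PI).
have cG : continuity_pt G K1.
  apply: continuity_pt_minus.
    apply: continuity_pt_mult; first exact: continuity_pt_const.
    exact: continuous_is_derive (is_derive_cn _ hk1 _).
  apply: (continuity_pt_comp (fun t => A * ((exp (s * t) + exp (- (s * t))) / 2) - PI) Rabs).
    apply/continuity_pt_filterlim.
    apply: (ex_derive_continuous (fun t => A * ((exp (s * t) + exp (- (s * t))) / 2) - PI)).
    by auto_derive.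
  exact: Rcontinuity_abs.
have G0 : 0 <= G K1.
  case: (Rle_lt_dec 0 (G K1)) => // neg.
  have [d hd] := proj1 (continuity_pt_locally _ _) cG (mkposreal (- G K1) ltac:(lra)).
  have d0 := cond_pos d.
  pose y := Rmax (K1 / 2) (K1 - d / 2).
  have hy1 : K1 / 2 <= y := Rmax_l _ _.
  have hy2 : K1 - d / 2 <= y := Rmax_r _ _.
  have hy3 : y < K1 by apply: Rmax_lub_lt; lra.
  have near : Rabs (y - K1) < d by apply: Rabs_def1; lra.
  have gy : 0 <= G y by have := bound y ltac:(lra); rewrite /G; lra.
  have := Rabs_def2 _ _ (hd y near) => /=; lra.
have c0 : jacobi_cn (sqrt (1 - k ^ 2)) K1 = 0 by exact: cn_K.
move: G0; rewrite /G c0 Rmult_0_r => h.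
have := Rabs_pos (A * ((exp (s * K1) + exp (- (s * K1))) / 2) - PI) => h'.
have e : Rabs (A * ((exp (s * K1) + exp (- (s * K1))) / 2) - PI) = 0 by lra.
have := Rabs_eq_0 _ e; lra.
Qed.

(** * Fejer means *)

Definition cos_mult (n : nat) : R := if n is 0%nat then 1 else 2.

Definition dirichlet (n : nat) (x : R) : R :=
  sum_f_R0 (fun s => cos_mult s * cos (INR s * x)) n.

(** The usual Fejer kernel without the normalizing factor 1 / (n + 1), which
    keeps [fejer_closed] free of divisions. *)
Definition fejer (n : nat) (x : R) : R := sum_f_R0 (fun j => dirichlet j x) n.

Lemma dirichlet_closed (n : nat) (x : R) :
  dirichlet n x * (1 - cos x) = cos (INR n * x) - cos (INR n.+1 * x).
Proof.
elim: n => [|n IH].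
  by rewrite /dirichlet /= Rmult_0_l cos_0 !Rmult_1_l.
rewrite /dirichlet /= -/(dirichlet n x) Rmult_plus_distr_r IH -/(INR n.+1).
have -> : (INR n.+1 + 1) * x = INR n.+1 * x + x by ring.
have -> : INR n * x = INR n.+1 * x - x by rewrite S_INR; ring.
by rewrite cos_plus cos_minus; ring.
Qed.

Lemma fejer_closed (n : nat) (x : R) :
  fejer n x * (1 - cos x) = 1 - cos (INR n.+1 * x).
Proof.
elim: n => [|n IH].
  by rewrite /fejer /= dirichlet_closed /= Rmult_0_l cos_0.
by rewrite /fejer tech5 -/(fejer n x) Rmult_plus_distr_r IH dirichlet_closed; ring.
Qed.

Lemma RInt_sum_f_R0 (f : nat -> R -> R) (a b : R) (n : nat) :
  (forall j x, continuous (f j) x) ->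
  (forall x, continuous (fun x => sum_f_R0 (fun j => f j x) n) x) /\
  RInt (fun x => sum_f_R0 (fun j => f j x) n) a b =
  sum_f_R0 (fun j => RInt (f j) a b) n.
Proof.
move=> hf; elim: n => [|n [IH1 IH2]] //=; split.
  by move=> x; apply: (continuous_plus (fun x => sum_f_R0 (fun j => f j x) n)).
rewrite -IH2; apply: (RInt_plus (fun x => sum_f_R0 (fun j => f j x) n));
  by apply: ex_RInt_continuous => x _.
Qed.

(** The integral over [u - K, u + K] has derivative g (u + K) - g (u - K) = 0
    in u. *)
Lemma RInt_periodic_shift (g : R -> R) (K u : R) (hg : forall x, continuous g x)
    (per : forall x, g (x + 2 * K) = g x) :
  RInt (fun y => g (u + y)) (- K) K = RInt g (- K) K.
Proof.
pose G x := RInt g 0 x.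
have dG x : is_derive G x (g x).
  apply: (is_derive_RInt g G 0) => //; apply: filter_forall => y.
  by apply: RInt_correct; apply: ex_RInt_continuous => z _.
have e v : RInt (fun y => g (v + y)) (- K) K = G (v + K) - G (v + - K).
  apply: is_RInt_unique; apply: (is_RInt_derive (fun y => G (v + y))) => y _.
    rewrite -[g (v + y)]Rmult_1_l; apply: (is_derive_comp G) => //.
    by auto_derive => //; ring.
  by apply: (continuous_comp (fun y => v + y) g) => //; apply: ex_derive_continuous; auto_derive.
rewrite e.
have -> : RInt g (- K) K = G (0 + K) - G (0 + - K).
  by rewrite -e; apply: RInt_ext => x _; rewrite Rplus_0_l.
apply: (is_derive_0_const (fun v => G (v + K) - G (v + - K))) => v.
have -> : 0 = 1 * g (v + K) - 1 * g (v + - K).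
  rewrite -(per (v + - K)); have -> : v + - K + 2 * K = v + K by ring.
  by rewrite Rminus_diag.
apply: is_derive_minus; apply: (is_derive_comp G) => //; by auto_derive => //; ring.
Qed.

Lemma continuous_dn (k : R) (hk : 0 < k < 1) (x : R) : continuous (jacobi_dn k) x.
Proof. by apply: ex_derive_continuous; eexists; exact: is_derive_dn. Qed.

Lemma continuous_cos_lin (a b x : R) : continuous (fun x => cos (a * x + b)) x.
Proof. by apply: ex_derive_continuous; auto_derive. Qed.

(** Translating dn by u and by - u multiplies its s-th Fourier mode by conjugate
    phases; averaging the two leaves a cosine. *)
Lemma dn_mean_coef (k : R) (hk : 0 < k < 1) (u : R) (s : nat) :
  RInt (fun y => (jacobi_dn k (u + y) + jacobi_dn k (u - y)) / 2
            * cos (INR s * (PI / ellip_K k * y))) (- ellip_K k) (ellip_K k)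
  = cos (INR s * (PI / ellip_K k * u)) *
    RInt (fun x => jacobi_dn k x * cos (INR s * (PI / ellip_K k) * x))
      (- ellip_K k) (ellip_K k).
Proof.
have hK := ellip_K_pos k hk.
set K := ellip_K k in hK *.
set c := INR s * (PI / K).
have cg b x : continuous (fun x => jacobi_dn k x * cos (c * x + b)) x.
  by apply: continuous_mult; [exact: continuous_dn | exact: continuous_cos_lin].
have per b x : jacobi_dn k (x + 2 * K) * cos (c * (x + 2 * K) + b)
     = jacobi_dn k x * cos (c * x + b).
  rewrite dn_period //; congr (_ * _); rewrite -(cos_period (c * x + b) s).
  by congr cos; rewrite /c; field; lra.
have half v : RInt (fun y => jacobi_dn k (v + y) * cos (c * y)) (- K) K =
    RInt (fun x => jacobi_dn k x * cos (c * x + - (c * v))) (- K) K.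
  rewrite -(RInt_periodic_shift _ K v (cg _) (per _)); apply: RInt_ext => y _.
  by congr (_ * cos _); ring.
have ex v : ex_RInt (fun y => jacobi_dn k (v + y) * cos (c * y)) (- K) K.
  apply: ex_RInt_continuous => y _; apply: continuous_mult.
    apply: (continuous_comp (fun y => v + y)); last exact: continuous_dn.
    by apply: ex_derive_continuous; auto_derive.
  by apply: ex_derive_continuous; auto_derive.
have ex' b : ex_RInt (fun x => jacobi_dn k x * cos (c * x + b)) (- K) K.
  by apply: ex_RInt_continuous => x _.
transitivity (/ 2 * (RInt (fun y => jacobi_dn k (u + y) * cos (c * y)) (- K) K +
                     RInt (fun y => jacobi_dn k (- u + y) * cos (c * y)) (- K) K)).
  rewrite -[RInt _ _ _ + _](RInt_plus _ _ _ _ (ex u) (ex (- u))).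
  rewrite -[RHS](RInt_scal _ _ _ (/ 2) (ex_RInt_plus _ _ _ _ (ex u) (ex (- u)))).
  apply: RInt_ext => y _.
  have -> : jacobi_dn k (u - y) = jacobi_dn k (- u + y).
    by rewrite -dn_opp //; congr jacobi_dn; ring.
  have -> : INR s * (PI / K * y) = c * y by rewrite /c; ring.
  by rewrite /scal /plus /= /mult /=; field.
rewrite !half -[RInt _ _ _ + _](RInt_plus _ _ _ _ (ex' _) (ex' _)).
have ex0 : ex_RInt (fun x => jacobi_dn k x * cos (c * x)) (- K) K.
  apply: ex_RInt_continuous => x _; apply: continuous_mult; first exact: continuous_dn.
  by apply: ex_derive_continuous; auto_derive.
rewrite -[RHS](RInt_scal _ _ _ (cos (INR s * (PI / K * u))) ex0).
rewrite -[LHS](RInt_scal _ _ _ (/ 2) (ex_RInt_plus _ _ _ _ (ex' _) (ex' _))).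
apply: RInt_ext => x _.
have -> : INR s * (PI / K * u) = c * u by rewrite /c; ring.
have -> : c * x + - (c * - u) = c * x + c * u by ring.
have -> : c * x + - (c * u) = c * x - c * u by ring.
by rewrite cos_plus cos_minus /scal /plus /= /mult /=; field.
Qed.

(** By the addition theorem the second difference is dn u / D times
    dn y - 1 + k^2 sn^2 u sn^2 y, which is at most sn^2 y <= y^2, and y^2 is
    comparable with 1 - cos (pi y / K) on the period. *)
Lemma dn_mean_bound (k : R) (hk : 0 < k < 1) (u y : R) (hy : - ellip_K k <= y <= ellip_K k) :
  Rabs ((jacobi_dn k (u + y) + jacobi_dn k (u - y)) / 2 - jacobi_dn k u) <=
  18 * ellip_K k ^ 2 / (PI ^ 2 * (1 - k ^ 2)) * (1 - cos (PI / ellip_K k * y)).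
Proof.
have hK := ellip_K_pos k hk; have hPI := PI_RGT_0.
set K := ellip_K k in hy hK *.
have [hD1 hD2] := addition_denominator_pos k hk u y.
have -> : (jacobi_dn k (u + y) + jacobi_dn k (u - y)) / 2 - jacobi_dn k u =
   jacobi_dn k u / (1 - k ^ 2 * jacobi_sn k u ^ 2 * jacobi_sn k y ^ 2) *
   (jacobi_dn k y - 1 + k ^ 2 * jacobi_sn k u ^ 2 * jacobi_sn k y ^ 2).
  have -> : u + y = u - - y by ring.
  rewrite !dn_sub // dn_opp // sn_opp // cn_opp //.
  by field; lra.
have hth : - PI <= PI / K * y <= PI.
  have -> : PI / K * y = PI * y / K by field; lra.
  split; [apply/Rle_div_r | apply/Rle_div_l]; nra.
have h1 := one_sub_cos_ge (PI / K * y) hth.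
have h2 := sn_sqr_le k hk y.
have k2 : 0 < 1 - k ^ 2 by nra.
have [[h3 h4] h5] := dn_bounds k hk y.
have [[_ h6] h7] := dn_bounds k hk u.
have h8 := dn2 k hk y.
have su := pow2_ge_0 (jacobi_sn k u); have sy := pow2_ge_0 (jacobi_sn k y).
have su1 : jacobi_sn k u ^ 2 <= 1 by have := sn2_cn2 k u; nra.
set e := _ - 1 + _.
have he : Rabs e <= jacobi_sn k y ^ 2.
  have : 0 <= k ^ 2 * jacobi_sn k u ^ 2 * jacobi_sn k y ^ 2 <= jacobi_sn k y ^ 2.
    have : 0 <= k ^ 2 * jacobi_sn k u ^ 2 <= 1 by split; nra.
    split; nra.
  move=> h9; apply: Rabs_le; rewrite /e; split; nra.
set D := 1 - k ^ 2 * jacobi_sn k u ^ 2 * jacobi_sn k y ^ 2 in hD1 hD2 *.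
rewrite Rabs_mult (Rabs_pos_eq (_ / _)); last by apply: Rdiv_le_0_compat; lra.
have hD : jacobi_dn k u / D <= / (1 - k ^ 2).
  rewrite /Rdiv -[X in _ <= X]Rmult_1_l; apply: Rmult_le_compat; try lra.
  - by apply/Rlt_le/Rinv_0_lt_compat.
  - exact: Rinv_le_contravar.
have hD0 : 0 <= jacobi_dn k u / D by apply: Rdiv_le_0_compat; lra.
apply: Rle_trans (Rmult_le_compat _ _ _ _ hD0 (Rabs_pos e) hD he) _.
have -> : 18 * K ^ 2 / (PI ^ 2 * (1 - k ^ 2)) * (1 - cos (PI / K * y)) =
  / (1 - k ^ 2) * (18 * (K / PI) ^ 2 * (1 - cos (PI / K * y))) by field; lra.
apply: Rmult_le_compat_l; first by apply/Rlt_le/Rinv_0_lt_compat.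
apply: Rle_trans h2 _.
have -> : y ^ 2 = (K / PI) ^ 2 * (PI / K * y) ^ 2 by field; lra.
have := pow2_ge_0 (K / PI); nra.
Qed.

Lemma exp_lin_INR (c : R) (n : nat) : exp (c * INR n) = exp c ^ n.
Proof.
elim: n => [|n IH]; first by rewrite Rmult_0_r exp_0.
by rewrite S_INR Rmult_plus_distr_l exp_plus IH Rmult_1_r /=; ring.
Qed.

Lemma nome_bounds (k : R) (hk : 0 < k < 1) : 0 < nome k < 1.
Proof.
have hK := ellip_K_pos k hk; have hPI := PI_RGT_0.
have hK1 := ellip_K_pos _ (proj1 (comodulus_bounds k hk)).
split; first exact: exp_pos.
rewrite -exp_0; apply: exp_increasing.
have -> : - PI * ellip_K (sqrt (1 - k ^ 2)) / ellip_K k =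
   - (PI * ellip_K (sqrt (1 - k ^ 2)) / ellip_K k) by field; lra.
have : 0 < PI * ellip_K (sqrt (1 - k ^ 2)) / ellip_K k.
  by apply: Rdiv_lt_0_compat => //; exact: Rmult_lt_0_compat.
lra.
Qed.

Lemma weight_of_nat (k : R) (hk : 0 < k < 1) (n : nat) :
  weight k (Z.of_nat n) = PI / ellip_K k * (1 / (nome k ^ n + / nome k ^ n)).
Proof.
have [h0 _] := nome_bounds k hk.
by rewrite /weight powerRZ_neg' -!pow_powerRZ.
Qed.

Lemma weight_opp (k : R) (s : Z) : weight k (- s) = weight k s.
Proof. by rewrite /weight Z.opp_involutive Rplus_comm. Qed.

Lemma weight_bounds (k : R) (hk : 0 < k < 1) (n : nat) :
  0 <= weight k (Z.of_nat n) <= PI / ellip_K k * nome k ^ n.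
Proof.
have [h0 _] := nome_bounds k hk.
have hK := ellip_K_pos k hk; have hPI := PI_RGT_0.
rewrite weight_of_nat //.
have hq : 0 < nome k ^ n by exact: pow_lt.
have hqi : 0 < / nome k ^ n by exact: Rinv_0_lt_compat.
have hc : 0 < PI / ellip_K k by exact: Rdiv_lt_0_compat.
split; first by apply: Rmult_le_pos; [lra | apply: Rdiv_le_0_compat; lra].
apply: Rmult_le_compat_l; first lra.
apply/Rle_div_l; first lra.
rewrite Rmult_plus_distr_l Rinv_r; nra.
Qed.

Lemma dn_coef_weight (k : R) (hk : 0 < k < 1) (n : nat) :
  RInt (fun x => jacobi_dn k x * cos (INR n * (PI / ellip_K k) * x))
      (- ellip_K k) (ellip_K k) = 2 * ellip_K k * weight k (Z.of_nat n).
Proof.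
have hK := ellip_K_pos k hk; have hPI := PI_RGT_0.
have hq : 0 < nome k ^ n by apply: pow_lt; exact: (proj1 (nome_bounds k hk)).
have hs : sin (INR n * (PI / ellip_K k) * ellip_K k) = 0.
  apply: sin_eq_0_1; exists (Z.of_nat n); rewrite -INR_IZR_INZ; field; lra.
have := dn_fourier_coef k hk _ hs; rewrite weight_of_nat //.
have -> : - (INR n * (PI / ellip_K k) * ellip_K (sqrt (1 - k ^ 2))) =
   (- PI * ellip_K (sqrt (1 - k ^ 2)) / ellip_K k) * INR n by field; lra.
have -> : INR n * (PI / ellip_K k) * ellip_K (sqrt (1 - k ^ 2)) =
   - ((- PI * ellip_K (sqrt (1 - k ^ 2)) / ellip_K k) * INR n) by field; lra.
rewrite exp_Ropp exp_lin_INR -/(nome k) => h.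
have hqi : 0 < / nome k ^ n by exact: Rinv_0_lt_compat.
apply: (Rmult_eq_reg_r (/ nome k ^ n + nome k ^ n)); last lra.
rewrite h; field; repeat split; try lra; nra.
Qed.

Lemma ex_series_weight (k : R) (hk : 0 < k < 1) (f : nat -> R)
    (hf : forall n, Rabs (f n) <= 2) :
  ex_series (fun n => weight k (Z.of_nat n) * f n).
Proof.
have [h0 h1] := nome_bounds k hk.
apply: (ex_series_le _ (fun n => 2 * (PI / ellip_K k) * nome k ^ n)) => [n|].
  have [h2 h3] := weight_bounds k hk n.
  rewrite /norm /= /abs /= Rabs_mult (Rabs_pos_eq (weight _ _)) //.
  have -> : 2 * (PI / ellip_K k) * nome k ^ n = PI / ellip_K k * nome k ^ n * 2 by ring.
  by apply: Rmult_le_compat => //; exact: Rabs_pos.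
apply: (ex_series_scal (2 * (PI / ellip_K k)) (fun n => nome k ^ n)).
by apply: ex_series_geom; rewrite Rabs_pos_eq; lra.
Qed.

Lemma RInt_dirichlet (K : R) (hK : 0 < K) (n : nat) :
  RInt (fun y => dirichlet n (PI / K * y)) (- K) K = 2 * K.
Proof.
have hPI := PI_RGT_0.
have cc j x : continuous (fun y => cos_mult j * cos (INR j * (PI / K * y))) x.
  by apply: ex_derive_continuous; auto_derive.
rewrite (proj2 (RInt_sum_f_R0 _ (- K) K n cc)).
have e0 : RInt (fun y => cos_mult 0 * cos (INR 0 * (PI / K * y))) (- K) K = 2 * K.
  rewrite (RInt_ext _ (fun _ => 1)) ?RInt_const /scal /= /mult /=; first by ring.
  by move=> x _; rewrite Rmult_0_l cos_0; ring.
have eS j : RInt (fun y => cos_mult j.+1 * cos (INR j.+1 * (PI / K * y))) (- K) K = 0.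
  have hj : INR j.+1 <> 0 by exact: not_0_INR.
  have h : is_RInt (fun y => cos_mult j.+1 * cos (INR j.+1 * (PI / K * y))) (- K) K
     (minus (2 * K / (INR j.+1 * PI) * sin (INR j.+1 * (PI / K * K)))
            (2 * K / (INR j.+1 * PI) * sin (INR j.+1 * (PI / K * - K)))).
    apply: (is_RInt_derive
      (fun y => 2 * K / (INR j.+1 * PI) * sin (INR j.+1 * (PI / K * y)))) => // x _.
    rewrite /cos_mult; auto_derive => //; rewrite -/(INR j.+1); field; repeat split => //; lra.
  rewrite (is_RInt_unique _ _ _ _ h).
  have -> : PI / K * - K = - (PI / K * K) by ring.
  have -> : PI / K * K = PI by field; lra.
  have hs : sin (INR j.+1 * PI) = 0.
    by apply: sin_eq_0_1; exists (Z.of_nat j.+1); rewrite -INR_IZR_INZ.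
  by rewrite Ropp_mult_distr_r_reverse sin_neg hs /minus /plus /opp /=; ring.
elim: n => [|n IH]; first exact: e0.
by rewrite tech5 eS IH Rplus_0_r.
Qed.

Definition fourier_term (k u : R) (n : nat) : R :=
  weight k (Z.of_nat n) * (cos_mult n * cos (INR n * (PI / ellip_K k * u))).

Lemma continuous_dn_mean (k : R) (hk : 0 < k < 1) (u x : R) :
  continuous (fun y => (jacobi_dn k (u + y) + jacobi_dn k (u - y)) / 2) x.
Proof.
have d y : ex_derive (jacobi_dn k) y by eexists; exact: is_derive_dn.
by apply: ex_derive_continuous; auto_derive.
Qed.

(** The j-th Dirichlet kernel has integral 2 K and picks out of the symmetric
    translate of dn exactly the j-th partial sum, by [dn_mean_coef]. *)
Lemma fejer_mean (k : R) (hk : 0 < k < 1) (u : R) (n : nat) :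
  RInt (fun y => ((jacobi_dn k (u + y) + jacobi_dn k (u - y)) / 2 - jacobi_dn k u)
            * fejer n (PI / ellip_K k * y)) (- ellip_K k) (ellip_K k)
  = 2 * ellip_K k *
    (sum_f_R0 (fun j => sum_f_R0 (fourier_term k u) j) n - INR n.+1 * jacobi_dn k u).
Proof.
have hK := ellip_K_pos k hk.
set K := ellip_K k in hK *.
pose h y := (jacobi_dn k (u + y) + jacobi_dn k (u - y)) / 2.
have ch x : continuous h x.
  exact: continuous_dn_mean.
have ct j x : continuous (fun y => cos_mult j * cos (INR j * (PI / K * y))) x.
  by apply: ex_derive_continuous; auto_derive.
have cd j x : continuous (fun y => dirichlet j (PI / K * y)) x.
  exact: (proj1 (RInt_sum_f_R0 _ 0 0 j ct) x).
have step j : RInt (fun y => (h y - jacobi_dn k u) * dirichlet j (PI / K * y)) (- K) K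
   = 2 * K * (sum_f_R0 (fourier_term k u) j - jacobi_dn k u).
  have e1 : RInt (fun y => h y * dirichlet j (PI / K * y)) (- K) K =
      2 * K * sum_f_R0 (fourier_term k u) j.
    have cht i x : continuous (fun y => h y * (cos_mult i * cos (INR i * (PI / K * y)))) x.
      exact: continuous_mult.
    rewrite (RInt_ext _ (fun y => sum_f_R0
      (fun i => h y * (cos_mult i * cos (INR i * (PI / K * y)))) j)); last first.
      by move=> y _; rewrite /dirichlet scal_sum; apply: sum_eq => i _; exact: Rmult_comm.
    rewrite (proj2 (RInt_sum_f_R0 _ (- K) K j cht)) scal_sum; apply: sum_eq => i _.
    have cht' x : continuous (fun y => h y * cos (INR i * (PI / K * y))) x.
      apply: continuous_mult => //; apply: ex_derive_continuous; auto_derive => //.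
    transitivity (cos_mult i * RInt (fun y => h y * cos (INR i * (PI / K * y))) (- K) K).
      rewrite -[RHS](RInt_scal (fun y => h y * cos (INR i * (PI / K * y)))); last first.
        by apply: ex_RInt_continuous => x _; exact: cht'.
      by apply: RInt_ext => x _; rewrite /scal /= /mult /=; ring.
    by rewrite dn_mean_coef // dn_coef_weight // /fourier_term -/K; ring.
  transitivity (RInt (fun y => h y * dirichlet j (PI / K * y)) (- K) K -
      RInt (fun y => jacobi_dn k u * dirichlet j (PI / K * y)) (- K) K).
    have p : ex_RInt (fun y => h y * dirichlet j (PI / K * y)) (- K) K.
      by apply: ex_RInt_continuous => x _; apply: continuous_mult.
    have q : ex_RInt (fun y => jacobi_dn k u * dirichlet j (PI / K * y)) (- K) K.
      by apply: ex_RInt_continuous => x _; apply: continuous_mult => //; exact: continuous_const.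
    rewrite -[RHS](RInt_minus _ _ _ _ p q).
    by apply: RInt_ext => x _; rewrite /minus /plus /opp /=; ring.
  rewrite e1; have -> : RInt (fun y => jacobi_dn k u * dirichlet j (PI / K * y)) (- K) K
     = jacobi_dn k u * (2 * K).
    rewrite -(RInt_dirichlet K hK j); apply: (RInt_scal (fun y => dirichlet j (PI / K * y))).
    by apply: ex_RInt_continuous => x _.
  by rewrite Rmult_minus_distr_l; congr (_ - _); exact: Rmult_comm.
have cs j x : continuous (fun y => (h y - jacobi_dn k u) * dirichlet j (PI / K * y)) x.
  apply: continuous_mult => //; apply: continuous_minus => //; exact: continuous_const.
rewrite (RInt_ext _ (fun y => sum_f_R0
  (fun j => (h y - jacobi_dn k u) * dirichlet j (PI / K * y)) n)); last first.
  by move=> y _; rewrite /fejer scal_sum; apply: sum_eq => i _; exact: Rmult_comm.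
rewrite (proj2 (RInt_sum_f_R0 _ (- K) K n cs)).
rewrite -/K; elim: n => [|n IH].
  by rewrite /sum_f_R0 step; congr (_ * (_ - _)); rewrite /=; ring.
rewrite tech5 step IH [in RHS]tech5 (S_INR n.+1) -Rmult_plus_distr_l; congr (_ * _); ring.
Qed.

(** The series converges absolutely, hence its Cesaro means have the same limit;
    and in [fejer_mean] the factor 1 - cos from [dn_mean_bound] cancels the
    growth of the Fejer kernel at 0, leaving an error of order 1 / n. *)
Lemma dn_fourier_series (k : R) (hk : 0 < k < 1) (u : R) :
  is_series (fourier_term k u) (jacobi_dn k u).
Proof.
have hK := ellip_K_pos k hk; have hPI := PI_RGT_0.
have k2 : 0 < 1 - k ^ 2 by nra.
have [l hl] : ex_series (fourier_term k u).
  apply: ex_series_weight => // n; rewrite Rabs_mult.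
  have h1 : Rabs (cos_mult n) <= 2 by case: n => [|n] /=; rewrite Rabs_pos_eq; lra.
  have h2 : Rabs (cos (INR n * (PI / ellip_K k * u))) <= 1.
    by apply: Rabs_le; have := COS_bound (INR n * (PI / ellip_K k * u)); lra.
  rewrite -[X in _ <= X]Rmult_1_r; apply: Rmult_le_compat => //; exact: Rabs_pos.
suff -> : jacobi_dn k u = l by [].
have cv : Un_cv (sum_f_R0 (fourier_term k u)) l.
  have hl' : is_lim_seq (sum_n (fourier_term k u)) l := hl.
  apply/is_lim_seq_Reals; apply: is_lim_seq_ext hl' => n; exact: sum_n_Reals.
have ces := Cesaro_1 _ _ cv.
(* the constant of [dn_mean_bound] *)
pose C := 18 * ellip_K k ^ 2 / (PI ^ 2 * (1 - k ^ 2)).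
have C0 : 0 <= C.
  apply: Rdiv_le_0_compat; first by have := pow2_ge_0 (ellip_K k); lra.
  by apply: Rmult_lt_0_compat => //; exact: pow_lt.
have bound n : Rabs (sum_f_R0 (fun j => sum_f_R0 (fourier_term k u) j) n / INR n.+1
      - jacobi_dn k u) <= 2 * C * / INR n.+1.
  have hn : 0 < INR n.+1 by exact: lt_0_INR (Nat.lt_0_succ n).
  have hF := fejer_mean k hk u n.
  have ct j x : continuous (fun y => cos_mult j * cos (INR j * (PI / ellip_K k * y))) x.
    by apply: ex_derive_continuous; auto_derive.
  have cd j x : continuous (fun y => dirichlet j (PI / ellip_K k * y)) x.
    exact: (proj1 (RInt_sum_f_R0 _ 0 0 j ct) x).
  have cf x : continuous (fun y => fejer n (PI / ellip_K k * y)) x.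
    exact: (proj1 (RInt_sum_f_R0 _ 0 0 n cd) x).
  have : Rabs (2 * ellip_K k *
    (sum_f_R0 (fun j => sum_f_R0 (fourier_term k u) j) n - INR n.+1 * jacobi_dn k u))
     <= (ellip_K k - - ellip_K k) * (2 * C).
    rewrite -hF; apply: abs_RInt_le_const; first lra.
      apply: ex_RInt_continuous => x _; apply: continuous_mult => //.
      apply: continuous_minus; last exact: continuous_const.
      exact: continuous_dn_mean.
    move=> y hy; rewrite Rabs_mult.
    have hb := dn_mean_bound k hk u y hy; rewrite -/C in hb.
    apply: Rle_trans (Rmult_le_compat_r _ _ _ (Rabs_pos _) hb) _.
    have h1 : 0 <= 1 - cos (PI / ellip_K k * y) by have := COS_bound (PI / ellip_K k * y); lra.
    rewrite -[X in C * X * _](Rabs_pos_eq _ h1) Rmult_assoc -Rabs_mult Rmult_comm.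
    rewrite [(1 - _) * _]Rmult_comm fejer_closed.
    apply: Rmult_le_compat_r => //; apply: Rabs_le.
    have := COS_bound (INR n.+1 * (PI / ellip_K k * y)); lra.
  rewrite Rabs_mult Rabs_pos_eq; last lra.
  move=> h.
  have h' : Rabs (sum_f_R0 (fun j => sum_f_R0 (fourier_term k u) j) n
      - INR n.+1 * jacobi_dn k u) <= 2 * C by nra.
  have -> : sum_f_R0 (fun j => sum_f_R0 (fourier_term k u) j) n / INR n.+1 - jacobi_dn k u
    = (sum_f_R0 (fun j => sum_f_R0 (fourier_term k u) j) n - INR n.+1 * jacobi_dn k u)
      * / INR n.+1 by field; lra.
  have hi : 0 < / INR n.+1 by exact: Rinv_0_lt_compat.
  rewrite Rabs_mult (Rabs_pos_eq (/ _)); last lra.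
  by apply: Rmult_le_compat_r => //; lra.
pose S n := sum_f_R0 (fun j => sum_f_R0 (fourier_term k u) j) n / INR n.+1.
have lim1 : is_lim_seq S l.
  by apply: (is_lim_seq_ext _ _ _ _
    (proj1 (is_lim_seq_incr_1 _ _) (proj2 (is_lim_seq_Reals _ _) ces))).
have inv0 : is_lim_seq (fun n => 2 * C * / INR n.+1) 0.
  have -> : 0 = 2 * C * 0 by ring.
  apply: (is_lim_seq_scal_l _ _ (Finite 0)).
  apply: (is_lim_seq_inv (fun n => INR n.+1) p_infty) => //.
  exact: (proj1 (is_lim_seq_incr_1 INR p_infty) is_lim_seq_INR).
have lim2 : is_lim_seq (fun n => S n - jacobi_dn k u) 0.
  apply/is_lim_seq_abs_0; apply: (is_lim_seq_le_le (fun _ => 0) _ _ 0 _ _ inv0).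
    by move=> n; split; [exact: Rabs_pos | exact: bound].
  exact: is_lim_seq_const.
have lim3 := is_lim_seq_minus' _ _ _ _ lim1 (is_lim_seq_const (jacobi_dn k u)).
have := is_lim_seq_unique _ _ lim2; rewrite (is_lim_seq_unique _ _ lim3) => -[]; lra.
Qed.

(** * Moments and orthogonality *)

Lemma is_series_pair (a b : nat -> R) (la lb : R) :
  is_series a la -> is_series b lb ->
  @is_series C_AbsRing C_NormedModule (fun n => (a n, b n)) (la, lb).
Proof.
move=> ha hb.
have e n : @sum_n C_AbsRing (fun n => (a n, b n) : C) n = (sum_n a n, sum_n b n).
  by elim: n => [|n IH]; rewrite ?sum_O // !sum_Sn IH.
apply/filterlim_locally => eps.
have [m hm] := proj1 (filterlim_locally _ _) ha eps.
have [m' hm'] := proj1 (filterlim_locally _ _) hb eps.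
exists (m + m')%coq_nat => n hn; rewrite e; split.
- by apply: hm; apply: Nat.le_trans hn; exact: Nat.le_add_r.
- by apply: hm'; apply: Nat.le_trans hn; exact: Nat.le_add_l.
Qed.

Lemma is_series_Z_ext (f g : Z -> C) (l : C) :
  (forall s, f s = g s) -> is_series_Z f l -> is_series_Z g l.
Proof.
move=> h [l1 [l2 [h1 [h2 ->]]]]; exists l1, l2; split; [|split] => //.
- by apply: is_series_ext h1.
- by apply: is_series_ext h2.
Qed.

Lemma is_series_Z_plus (f g : Z -> C) (l l' : C) :
  is_series_Z f l -> is_series_Z g l' -> is_series_Z (fun s => f s + g s)%C (l + l')%C.
Proof.
move=> [l1 [l2 [h1 [h2 ->]]]] [l1' [l2' [h1' [h2' ->]]]].
exists (l1 + l1')%C, (l2 + l2')%C; split; [|split].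
- exact: is_series_plus h1 h1'.
- exact: is_series_plus h2 h2'.
- by ring.
Qed.

Lemma is_series_Z_scal (c : C) (f : Z -> C) (l : C) :
  is_series_Z f l -> is_series_Z (fun s => c * f s)%C (c * l)%C.
Proof.
move=> [l1 [l2 [h1 [h2 ->]]]].
exists (c * l1)%C, (c * l2)%C; split; [|split].
- exact: (is_series_scal c _ _ h1).
- exact: (is_series_scal c _ _ h2).
- by ring.
Qed.

Lemma is_series_Z_sum_n (f : nat -> Z -> C) (l : nat -> C) (n : nat) :
  (forall j, is_series_Z (f j) (l j)) ->
  is_series_Z (fun s => @sum_n C_AbsRing (fun j => f j s) n) (@sum_n C_AbsRing l n).
Proof.
move=> h; elim: n => [|n IH].
  by rewrite sum_O; apply: is_series_Z_ext (h 0%nat) => s; rewrite sum_O.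
rewrite sum_Sn; apply: is_series_Z_ext (is_series_Z_plus _ _ _ _ IH (h n.+1)) => s.
by rewrite sum_Sn.
Qed.

Lemma sum_n_RtoC (f : nat -> R) (n : nat) :
  @sum_n C_AbsRing (fun i => RtoC (f i)) n = RtoC (\sum_(i < n.+1) f i)%ring.
Proof.
elim: n => [|n IH]; first by rewrite sum_O big_ord1.
by rewrite sum_Sn IH [in RHS]big_ord_recr /= -RplusE RtoC_plus.
Qed.

Lemma Cexpi_plus (x y : R) : Cexpi (x + y) = (Cexpi x * Cexpi y)%C.
Proof. by rewrite /Cexpi /Cmult /= cos_plus sin_plus; apply: injective_projections => /=; ring. Qed.

Lemma Cexpi_0 : Cexpi 0 = RtoC 1.
Proof. by rewrite /Cexpi cos_0 sin_0. Qed.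

Lemma Cexpi_pow (x : R) (n : nat) : (Cexpi x ^ n)%C = Cexpi (INR n * x).
Proof.
elim: n => [|n IH]; first by rewrite Rmult_0_l Cexpi_0.
by rewrite Cpow_S IH -Cexpi_plus S_INR; congr Cexpi; ring.
Qed.

Lemma Cexpi_inv (x : R) : (1 / Cexpi x)%C = Cexpi (- x).
Proof.
have e : (Cexpi x * Cexpi (- x))%C = RtoC 1.
  by rewrite -Cexpi_plus Rplus_opp_r Cexpi_0.
have ne : Cexpi x <> 0%C.
  move=> h; move: e; rewrite h Cmult_0_l => /RtoC_inj; lra.
rewrite -e; field; exact: ne.
Qed.

(** The sum over s >= 0 has real part c and imaginary part d; the sum over s < 0
    is its conjugate without the term s = 0.  The imaginary parts cancel and
    the real parts add up to the cosine series of dn. *)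
Lemma dn_moment (k : R) (hk : 0 < k < 1) (u : R) :
  is_series_Z (fun s => RtoC (weight k s) * Cexpi (PI / ellip_K k * u * IZR s))%C
    (RtoC (jacobi_dn k u)).
Proof.
set x := PI / ellip_K k * u.
pose W n := weight k (Z.of_nat n).
have b1 (t : R) : - 1 <= t <= 1 -> Rabs t <= 2 by move=> h; apply: Rabs_le; lra.
have [c hc] : ex_series (fun n => W n * cos (INR n * x)).
  by apply: ex_series_weight => // n; exact/b1/COS_bound.
have [d hd] : ex_series (fun n => W n * sin (INR n * x)).
  by apply: ex_series_weight => // n; exact/b1/SIN_bound.
have hc' : is_series (fun n => W n.+1 * cos (INR n.+1 * x)) (c - W 0%nat).
  apply: (is_series_incr_1 (fun n => W n * cos (INR n * x))).
  rewrite Rmult_0_l cos_0 /plus /=.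
  by have -> : c - W 0%nat + W 0%nat * 1 = c by ring.
have hd' : is_series (fun n => W n.+1 * sin (INR n.+1 * x)) d.
  apply: (is_series_incr_1 (fun n => W n * sin (INR n * x))).
  rewrite Rmult_0_l sin_0 /plus /=.
  by have -> : d + W 0%nat * 0 = d by ring.
have hf : is_series (fun n => 2 * (W n.+1 * cos (INR n.+1 * x))) (jacobi_dn k u - W 0%nat).
  have e n : fourier_term k u n.+1 = 2 * (W n.+1 * cos (INR n.+1 * x)).
    by rewrite /fourier_term /W /x; cbn [cos_mult]; ring.
  apply: (is_series_ext _ _ _ e).
  apply: is_series_incr_1; rewrite /fourier_term Rmult_0_l cos_0 /plus /cos_mult -/(W 0%nat) /=.
  have -> : jacobi_dn k u - W 0%nat + W 0%nat * (1 * 1) = jacobi_dn k u by ring.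
  exact: dn_fourier_series.
have val : jacobi_dn k u - W 0%nat = 2 * (c - W 0%nat).
  rewrite -(is_series_unique _ _ hf).
  exact: (is_series_unique _ _ (is_series_scal 2 _ _ hc')).
exists (c, d), (c - W 0%nat, - d); split; [|split].
- apply: is_series_ext (is_series_pair _ _ _ _ hc hd) => n.
  rewrite /Cexpi /Cmult /= -INR_IZR_INZ (Rmult_comm x) /W.
  by apply: injective_projections => /=; ring.
- have hd2 := is_series_opp _ _ hd'.
  apply: is_series_ext (is_series_pair _ _ _ _ hc' hd2) => n.
  rewrite /Cexpi /Cmult weight_opp opp_IZR -INR_IZR_INZ -/(W n.+1).
  have -> : x * - INR n.+1 = - (INR n.+1 * x) by ring.
  rewrite cos_neg sin_neg; cbn [fst snd RtoC].
  by rewrite /opp; cbn -[INR W]; apply: injective_projections => /=; ring.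
- by rewrite /Cplus /= /RtoC; apply: injective_projections => /=; lra.
Qed.

Lemma Ceval_Phi (a : nat -> R) (n : nat) (x : R) :
  Ceval (Phi a n) (Cexpi x) =
  @sum_n C_AbsRing (fun i => (RtoC ((Phi a n)`_i)%ring * Cexpi (INR i * x))%C) n.
Proof.
rewrite /Ceval (proj1 (size_Phi a n)); apply: sum_n_ext => i.
by rewrite Cexpi_pow.
Qed.

Theorem theorem2 (k w : R) (a : nat -> R)
  (hk : (0 < k < 1)%R)
  (hw : irrational (w / ellip_K k)%R)
  (ha_even : forall n : nat,
     a (2 * n)%nat = jacobi_dn k (w * INR (2 * n + 1)%nat)%R)
  (ha_odd : forall n : nat,
     a (2 * n + 1)%nat = (- jacobi_cn k (w * INR (2 * n + 2)%nat))%R) :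
  forall n m : nat,
    is_series_Z
      (fun s : Z =>
         (RtoC (weight k s) * Ceval (Phi a n) (node k w s)
          * Ceval (Phi a m) (1 / node k w s))%C)
      (RtoC (if n == m then hnorm a n else 0%R)).
Proof.
move=> n m.
have ha j : a j = (- 1) ^ j * reflection_fun k j (w * INR j.+1).
  have sq1 i : (- 1) ^ (2 * i)%nat = 1 by exact: pow_1_even.
  rewrite -[j]odd_double_half -mul2n /reflection_fun oddD oddM.
  case: (odd j); rewrite [odd _ (+) _]/=.
    by rewrite addnC ha_odd addn1 addn2 -tech_pow_Rmult sq1; ring.
  by rewrite add0n ha_even addn1 sq1; ring.
rewrite -(Phi_orthogonal k w a hk ha n m).
pose c j i := RtoC (((Phi a m)`_j)%ring * ((Phi a n)`_i)%ring)%R.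
have e : RtoC (\sum_(j < m.+1) (Phi a m)`_j * Phi_pairing a (jacobi_dn k) w n (w * INR j)%R)%ring
  = @sum_n C_AbsRing (fun j => @sum_n C_AbsRing (fun i =>
      (c j i * RtoC (jacobi_dn k (w * INR j - w * INR i)))%C) n) m.
  rewrite -(sum_n_RtoC (fun j =>
    ((Phi a m)`_j * Phi_pairing a (jacobi_dn k) w n (w * INR j)%R)%ring)).
  apply: sum_n_ext => j.
  rewrite /Phi_pairing GRing.mulr_sumr.
  rewrite -(sum_n_RtoC (fun i =>
    ((Phi a m)`_j * ((Phi a n)`_i * jacobi_dn k (w * INR j - w * INR i)%R))%ring)).
  by apply: sum_n_ext => i; rewrite -!RmultE /c -RtoC_mult; congr RtoC; ring.
rewrite e.
pose T j i s := (c j i * (RtoC (weight k s) *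
  Cexpi (PI / ellip_K k * (w * INR i - w * INR j) * IZR s)))%C.
apply: (is_series_Z_ext (fun s =>
  @sum_n C_AbsRing (fun j => @sum_n C_AbsRing (fun i => T j i s) n) m)).
- move=> s; rewrite /node Cexpi_inv !Ceval_Phi.
  set A := (fun i : nat => (RtoC ((Phi a n)`_i)%ring *
    Cexpi (INR i * (PI * w * IZR s / ellip_K k)))%C).
  set B := (fun j : nat => (RtoC ((Phi a m)`_j)%ring *
    Cexpi (INR j * - (PI * w * IZR s / ellip_K k)))%C).
  transitivity (@sum_n C_AbsRing (fun j => (RtoC (weight k s) * @sum_n C_AbsRing A n * B j)%C) m);
    last exact: (sum_n_mult_l (K := C_Ring)).
  apply: sum_n_ext => j.
  transitivity (@sum_n C_AbsRing (fun i => (RtoC (weight k s) * B j * A i)%C) n); last first.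
    transitivity (RtoC (weight k s) * B j * @sum_n C_AbsRing A n)%C; last first.
      move: (weight k s) (B j) (@sum_n C_AbsRing A n) => x y z.
      by rewrite -!Cmult_assoc (Cmult_comm y).
    exact: (sum_n_mult_l (K := C_Ring)).
  apply: sum_n_ext => i; rewrite /T /c /A /B.
  have -> : PI / ellip_K k * (w * INR i - w * INR j) * IZR s =
    INR i * (PI * w * IZR s / ellip_K k) + INR j * - (PI * w * IZR s / ellip_K k).
    by rewrite /Rdiv; ring.
  rewrite Cexpi_plus RtoC_mult.
  move: (RtoC (weight k s)) (RtoC (((Phi a m)`_j)%ring)) (RtoC (((Phi a n)`_i)%ring)) => x1 x2 x3.
  move: (Cexpi (INR i * _)) (Cexpi (INR j * _)) => x4 x5.
  apply: (eq_trans (y := (x1 * (x2 * x5) * (x3 * x4))%C)) => //.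
  by ring.
- apply: is_series_Z_sum_n => j; apply: is_series_Z_sum_n => i.
  apply: is_series_Z_scal.
  have -> : w * INR j - w * INR i = - (w * INR i - w * INR j) by ring.
  by rewrite dn_opp //; exact: dn_moment.
Qed.
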